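(* Let $(K,\xi)$ be a divisibly weighted simplicial complex. (i) The map $Sd_{\#}:(C_*(K),\partial^{\xi})\to(C_*(Sd(K)),\partial^{Sd(\xi)})$ is a chain homotopy equivalence, which induces an isomorphism $Sd_*:H_*(K,\partial^{\xi})\to H_*(Sd(K),\partial^{Sd(\xi)})$. (ii) For the inversion $\widehat{\xi}$ of $\xi$, there exists a chain map $\widehat{Sd}_{\#}:(C_*(K),\partial^{\widehat{\xi}})\to(C_*(Sd(K)),\partial^{\widehat{Sd(\xi)}})$ which induces an isomorphism $\widehat{Sd}_*:H_*(K,\partial^{\widehat{\xi}})\to H_*(Sd(K),\partial^{\widehat{Sd(\xi)}})$.
   Context: Simplicial complexes are finite; homology has integer coefficients. An ascending weight on a simplicial complex $K$ is a function $\mu$ from the simplices of $K$ to the positive integers with $\mu(\sigma')\mid\mu(\sigma)$ whenever $\sigma'$ is a face of $\sigma$; a descending weight satisfies instead $\mu(\sigma)\mid\mu(\sigma')$. On the oriented simplicial chain groups $C_n(K)$ put $\partial^{\mu}\sigma=\sum_{j=0}^n(-1)^jc_j\,\partial_j\sigma$, where $\partial_j[v_0,\dots,v_n]=[v_0,\dots,\widehat{v}_j,\dots,v_n]$ and $c_j=\mu(\sigma)/\mu(\partial_j\sigma)$ if $\mu$ is ascending, $c_j=\mu(\partial_j\sigma)/\mu(\sigma)$ if $\mu$ is descending; $H_*(K,\partial^\mu)$ is the homology of $(C_*(K),\partial^\mu)$. A weight $\xi$ (of either type) is divisible, and $(K,\xi)$ is divisibly weighted, if the vertices of every simplex $\sigma$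 can be ordered $v_0,\dots,v_k$ with $\xi(v_0)\mid\cdots\mid\xi(v_k)$ and $\xi(\sigma)=\xi(v_k)$ (ascending case) or $\xi(\sigma)=\xi(v_0)$ (descending case). The inversion $\widehat{\xi}$ of a divisible weight $\xi$ is the divisible weight of the opposite type with the same values on vertices. $Sd(K)$ is the barycentric subdivision, with simplices $\{b_{\sigma_0},\dots,b_{\sigma_l}\}$, $\sigma_0\subsetneq\cdots\subsetneq\sigma_l$ in $K$ ($b_\sigma$ the barycenter of $\sigma$), carrying the weight $Sd(\xi)(\{b_{\sigma_0},\dots,b_{\sigma_l}\})=\xi(\sigma_l)$, which is divisible and of the same type as $\xi$; $\widehat{Sd(\xi)}$ is the inversion of $Sd(\xi)$. The map $Sd_{\#}:C_*(K)\to C_*(Sd(K))$ is the usual subdivision operator, defined inductively by $Sd_{\#}(v)=v$ for vertices and $Sd_{\#}(\sigma)=b_{\sigma}\cdot Sd_{\#}(\partial\sigma)$, where $\partial$ is the ordinary simplicial boundary and $b_\sigma\cdot$ denotes coning from $b_\sigma$; it is a chain map for the weighted boundaries $\partial^{\xi}$ and $\partial^{Sd(\xi)}$. *)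

(* Defs.v *)
From HB Require Import structures.
From mathcomp Require Import all_boot all_order all_algebra.
From mathcomp Require Import ring_quotient boolp zify ring.

Set Implicit Arguments.
Unset Strict Implicit.
Unset Printing Implicit Defensive.

Import GRing.Theory.
Local Open Scope quotient_scope.
Local Open Scope ring_scope.

Section Homology.

Variables (C : nat -> zmodType) (d : forall n, {additive C n.+1 -> C n}).

Definition cycle n : {pred C n} :=
  match n return {pred C n} with
  | 0 => predT
  | m.+1 => fun x => d m x == 0
  end.

Lemma cycle_zmod_closed n : zmod_closed (@cycle n).
Proof.
case: n => [|n]; split => //; rewrite ?unfold_in /= ?raddf0 //.
move=> x y; rewrite !unfold_in /= => /eqP dx /eqP dy.
by rewrite raddfB dx dy subr0.
Qed.

HB.instance Definition _ n :=
  GRing.isZmodClosed.Build (C n) (@cycle n) (cycle_zmod_closed n).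

Record cycles n := Cycle { cycle_val :> C n; _ : cycle cycle_val }.

HB.instance Definition _ n := [isSub for @cycle_val n].
HB.instance Definition _ n := [Choice of cycles n by <:].
HB.instance Definition _ n := [SubChoice_isSubZmodule of cycles n by <:].

(* The cycles that bound.  The inclusion of the boundaries in the cycles,
   i.e. d o d = 0, is wboundary_wboundary for the complexes used below. *)
Definition boundary_pred n : {pred cycles n} :=
  fun z => `[< exists y : C n.+1, val z = d n y >].

Lemma boundary_zmod_closed n : zmod_closed (@boundary_pred n).
Proof.
split; first by apply/asboolP; exists 0; rewrite !raddf0.
move=> x y /asboolP[u xu] /asboolP[v yv]; apply/asboolP; exists (u - v).
by rewrite !raddfB /= -xu -yv.
Qed.

HB.instance Definition _ n :=
  GRing.isZmodClosed.Build (cycles n) (@boundary_pred n)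
    (boundary_zmod_closed n).

Definition homology n : zmodType :=
  Quotient.quot (@boundary_pred n : zmodClosed (cycles n)).

End Homology.

Section Homology_class.

Variables (C : nat -> zmodType) (d : forall n, {additive C n.+1 -> C n}).

Definition hclass n : cycles d n -> homology d n := \pi_(homology d n).

Lemma hclass_eqP n (x y : cycles d n) :
  hclass x = hclass y <-> exists c, val x - val y = d n c.
Proof.
split=> [xy|[c xyc]].
  have : x == y %[mod homology d n] by apply/eqP.
  by rewrite eqmodE /= => /asboolP[c]; rewrite raddfB => xyc; exists c.
apply/eqP; rewrite eqmodE /=; apply/asboolP; exists c.
by rewrite raddfB.
Qed.

Lemma hclass_repr n (x : homology d n) : hclass (repr x) = x.
Proof. exact: reprK. Qed.

Lemma hclass_is_zmod_morphism n : zmod_morphism (@hclass n).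
Proof. by move=> x y; rewrite /hclass [LHS]raddfB. Qed.

HB.instance Definition _ n :=
  GRing.isZmodMorphism.Build (cycles d n) (homology d n) (@hclass n)
    (@hclass_is_zmod_morphism n).

End Homology_class.

Section Chain_maps.

Variables (C D : nat -> zmodType).
Variables (dC : forall n, {additive C n.+1 -> C n}).
Variables (dD : forall n, {additive D n.+1 -> D n}).

Definition is_chain_map (f : forall n, {additive C n -> D n}) : Prop :=
  forall n (c : C n.+1), f n (dC n c) = dD n (f n.+1 c).

Definition chain_homotopic (f g : forall n, C n -> D n) : Prop :=
  exists h : forall n, {additive C n -> D n.+1},
    (forall c : C 0, f 0 c - g 0 c = dD 0 (h 0 c)) /\
    (forall n (c : C n.+1),
       f n.+1 c - g n.+1 c = dD n.+1 (h n.+1 c) + h n (dC n c)).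

Section Induced_map.

Variables (f : forall n, {additive C n -> D n}) (fd : is_chain_map f).

Lemma chain_map_cycle n (z : cycles dC n) : cycle dD (f n (val z)).
Proof.
case: n z => [//|n] [c] /= /eqP dc.
by apply/eqP; rewrite -fd dc raddf0.
Qed.

Definition cycles_map n (z : cycles dC n) : cycles dD n :=
  Cycle (chain_map_cycle z).

(* The map induced by f on homology, computed on a chosen representative;
   hmapE shows that the choice is irrelevant. *)
Definition hmap n (x : homology dC n) : homology dD n :=
  hclass (cycles_map (repr x)).

Lemma hmapE n (z : cycles dC n) : hmap (hclass z) = hclass (cycles_map z).
Proof.
apply/hclass_eqP => /=.
have /hclass_eqP[c zc] := hclass_repr (hclass z).
by exists (f n.+1 c); rewrite -fd -zc raddfB.
Qed.

Lemma hmap_is_zmod_morphism n : zmod_morphism (@hmap n).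
Proof.
move=> x y; rewrite -[x]hclass_repr -[y]hclass_repr -raddfB !hmapE -raddfB.
by congr hclass; apply: val_inj; rewrite /= !raddfB.
Qed.

HB.instance Definition _ n :=
  GRing.isZmodMorphism.Build (homology dC n) (homology dD n) (@hmap n)
    (@hmap_is_zmod_morphism n).

End Induced_map.

End Chain_maps.

Definition chain_homotopy_equivalence (C D : nat -> zmodType)
    (dC : forall n, {additive C n.+1 -> C n})
    (dD : forall n, {additive D n.+1 -> D n})
    (f : forall n, {additive C n -> D n}) : Prop :=
  is_chain_map dC dD f /\
  exists g : forall n, {additive D n -> C n},
    [/\ is_chain_map dD dC g,
        chain_homotopic dC dC (fun n => g n \o f n) (fun n => idfun) &
        chain_homotopic dD dD (fun n => f n \o g n) (fun n => idfun)].

Record simplicial_complex (V : finType) := SimplicialComplex {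
  simplices :> {set {set V}};
  simplex_neq0 : forall s, s \in simplices -> s != set0;
  face_closed : forall s t : {set V},
    s \in simplices -> t \subset s -> t != set0 -> t \in simplices
}.

Section Lin_ext.

Variables (I : finType) (M : zmodType).

Definition lin_ext (F : I -> M) (c : {ffun I -> int}) : M :=
  \sum_i F i *~ c i.

Lemma lin_ext_is_zmod_morphism F : zmod_morphism (lin_ext F).
Proof.
move=> a b; rewrite /lin_ext -sumrB; apply: eq_bigr => i _.
by rewrite !ffunE mulrzBr.
Qed.

HB.instance Definition _ F :=
  GRing.isZmodMorphism.Build {ffun I -> int} M (lin_ext F)
    (lin_ext_is_zmod_morphism F).

End Lin_ext.

Section Chains.

Variables (V : finType) (K : simplicial_complex V).

Definition simplex n := {s : {set V} | (s \in simplices K) && (#|s| == n.+1)}.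

(* The oriented chain group C_n(K): each n-simplex s is given the reference
   orientation [enum s], and c s is the coefficient of c at it. *)
Definition chain n : zmodType := {ffun simplex n -> int}.

Fixpoint inversions (t : seq V) : nat :=
  if t is x :: t' then
    count (fun y => enum_rank y < enum_rank x)%N t' + inversions t'
  else 0.

(* The oriented simplex [v_0, ..., v_n] as a chain: the sign of the
   permutation sorting the vertices, times the reference generator.  It is 0
   if the vertices are repeated or do not span an n-simplex of K. *)
Definition oriented n (t : seq V) : chain n :=
  [ffun s : simplex n =>
     if perm_eq t (enum (val s)) then (-1) ^+ inversions t else 0].

(* The list t without its j-th entry. *)
Definition face j (t : seq V) : seq V := take j t ++ drop j.+1 t.

(* The boundary with coefficient a s s' at the codimension one face s' of s. *)
Definition boundary (a : {set V} -> {set V} -> nat) n :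
    {additive chain n.+1 -> chain n} :=
  lin_ext (fun s : simplex n.+1 =>
    \sum_(j < n.+2)
      oriented n (face j (enum (val s))) *~
        ((-1) ^+ j * (a (val s) [set x in face j (enum (val s))])%:Z)).

Definition cone (b : V) n : {additive chain n -> chain n.+1} :=
  lin_ext (fun s : simplex n => oriented n.+1 (b :: enum (val s))).

End Chains.

Inductive weight_type := Ascending | Descending.

Definition opposite ty :=
  match ty with Ascending => Descending | Descending => Ascending end.

Section Weights.

Variables (V : finType) (ty : weight_type) (K : simplicial_complex V).

(* A weight is a function on all subsets of V, of which only the values on
   the simplices of K matter. *)
Definition is_weight (mu : {set V} -> nat) : Prop :=
  (forall s, s \in simplices K -> (0 < mu s)%N) /\
  forall s s' : {set V}, s \in simplices K -> s' \in simplices K ->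
    s' \subset s ->
    match ty with
    | Ascending => (mu s' %| mu s)%N
    | Descending => (mu s %| mu s')%N
    end.

Definition weight_coef (mu : {set V} -> nat) (s s' : {set V}) : nat :=
  match ty with
  | Ascending => mu s %/ mu s'
  | Descending => mu s' %/ mu s
  end.

Definition wboundary (mu : {set V} -> nat) n :
    {additive chain K n.+1 -> chain K n} :=
  boundary K (weight_coef mu) n.

Definition is_divisible (xi : {set V} -> nat) : Prop :=
  is_weight xi /\
  forall s, s \in simplices K -> exists v0 (vs : seq V),
    [/\ perm_eq (v0 :: vs) (enum s),
        sorted dvdn [seq xi [set v] | v <- v0 :: vs] &
        xi s = match ty with
               | Ascending => xi [set last v0 vs]
               | Descending => xi [set v0]
               end].

End Weights.

Definition is_inversion (V : finType) (ty : weight_type)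
    (K : simplicial_complex V) (xi xihat : {set V} -> nat) : Prop :=
  is_divisible (opposite ty) K xihat /\
  forall v, [set v] \in simplices K -> xihat [set v] = xi [set v].

Section Subdivision.

Variables (V : finType) (K : simplicial_complex V).

(* The barycenter of a simplex s of K is encoded by s itself, so that the
   vertices of Sd K live in {set V}. *)
Definition flags : {set {set {set V}}} :=
  [set C : {set {set V}} |
     [&& C != set0, C \subset simplices K &
         [forall s in C, forall t in C, (s \subset t) || (t \subset s)]]].

Lemma flag_neq0 C : C \in flags -> C != set0.
Proof. by rewrite inE => /and3P[]. Qed.

Lemma flag_face (C D : {set {set V}}) :
  C \in flags -> D \subset C -> D != set0 -> D \in flags.
Proof.
rewrite !inE => /and3P[_ CK /'forall_in_'forall_in_orP Cc] /[dup] DC /subsetP sDC ->.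
rewrite (subset_trans DC CK) /=.
by apply/'forall_in_'forall_in_orP => s /sDC sC t /sDC tC; apply: Cc.
Qed.

Definition Sd : simplicial_complex {set V} :=
  SimplicialComplex flag_neq0 flag_face.

(* The largest member of a flag is its union. *)
Definition Sd_weight (xi : {set V} -> nat) (C : {set {set V}}) : nat :=
  xi (cover C).

(* In the boundary below all coefficients are 1: it is the ordinary one.  In
   degree 0, the vertex v of K becomes the vertex [set v] of Sd K. *)
Fixpoint Sd_op n : {additive chain K n -> chain Sd n} :=
  match n return {additive chain K n -> chain Sd n} with
  | 0 => lin_ext (fun s : simplex K 0 => oriented Sd 0 [:: val s])
  | m.+1 => lin_ext (fun s : simplex K m.+1 =>
      cone Sd (val s) m
        (Sd_op m (boundary K (fun _ _ => 1%N) m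
                    (oriented K m.+1 (enum (val s))))))
  end.

End Subdivision.
Section Orientation.

Variables (V : finType) (K : simplicial_complex V).

Definition rank_in (s : {set V}) (x : V) : nat :=
  #|[set y in s | (enum_rank y < enum_rank x)%N]|.

Lemma inversions_cat_cons (t1 t2 : seq V) x :
  inversions (t1 ++ x :: t2) =
  (inversions (t1 ++ t2) +
   (count (fun y => enum_rank x < enum_rank y) t1 +
    count (fun y => enum_rank y < enum_rank x) t2))%N.
Proof.
elim: t1 => [|y t1 IH] /=; first by rewrite add0n addnC.
rewrite IH !count_cat /=; lia.
Qed.

Lemma count_rank_in (s : {set V}) (t : seq V) x :
  perm_eq t (enum s) ->
  count (fun y => enum_rank y < enum_rank x)%N t = rank_in s x.
Proof.
move=> /permP->; rewrite -size_filter /rank_in [RHS]cardE; congr size.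
by rewrite -filter_predI; apply: eq_filter => y /=; rewrite !inE andbC.
Qed.

Lemma sign_face (s : {set V}) (t1 t2 : seq V) x :
  perm_eq (t1 ++ x :: t2) (enum s) ->
  (-1) ^+ (inversions (t1 ++ t2) + size t1) =
  (-1) ^+ (inversions (t1 ++ x :: t2) + rank_in s x) :> int.
Proof.
move=> ts; rewrite -(count_rank_in x ts) inversions_cat_cons.
have xt1 : x \notin t1.
  have := enum_uniq s; rewrite -(perm_uniq ts) cat_uniq /= negb_or.
  by case/and3P=> _ /andP[].
have -> : size t1 = (count (fun y => enum_rank x < enum_rank y) t1 +
                     count (fun y => enum_rank y < enum_rank x) t1)%N.
  rewrite -(count_predC (fun y => enum_rank x < enum_rank y)%N); congr addn.
  apply: eq_in_count => y yt1 /=; rewrite -leqNgt leq_eqVlt orb_idl //.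
  by move=> /eqP/val_inj/enum_rank_inj yx; rewrite -yx yt1 in xt1.
rewrite count_cat /= ltnn add0n -signr_odd -[RHS]signr_odd; congr (_ ^+ _).
by rewrite !oddD; move: (odd _) (odd _) (odd _) (odd _) => [] [] [] [].
Qed.

Lemma inversions_enum (s : {set V}) : inversions (enum s) = 0%N.
Proof.
pose r (x y : V) := (enum_rank x <= enum_rank y)%N.
have inv0 t : pairwise r t -> inversions t = 0%N.
  elim: t => //= x t IH /andP[/allP xt /IH->]; rewrite addn0.
  by apply/eqP; rewrite eqn0Ngt -has_count; apply/hasPn => y /xt; rewrite -leqNgt.
apply: inv0; rewrite {1}/enum_mem; apply: pairwise_filter.
have := @pairwise_map _ _ (fun x : V => val (enum_rank x)) leq (Finite.enum V).
rewrite /r /relpre => <-.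
have -> : [seq val (enum_rank i) | i <- Finite.enum V] = iota 0 #|V|.
  rewrite -(enumT V); apply: (@eq_from_nth _ 0%N).
    by rewrite size_map -cardE size_iota.
  rewrite size_map -cardE => i iV; pose j : 'I_#|V| := Ordinal iV.
  rewrite (nth_map (enum_val j)) -?cardE // -[i]/(val j).
  by rewrite -(enum_val_nth (enum_val j)) enum_valK nth_iota.
by rewrite -(sorted_pairwise leq_trans) iota_sorted.
Qed.

Lemma perm_face (s : {set V}) (t1 t2 : seq V) x :
  perm_eq (t1 ++ x :: t2) (enum s) -> perm_eq (t1 ++ t2) (enum (s :\ x)).
Proof.
move=> ts; have us := enum_uniq s; rewrite -(perm_uniq ts) in us.
apply: uniq_perm; rewrite ?enum_uniq //.
  by move: us; rewrite (perm_uniq (permEl (perm_catCA t1 [:: x] t2))) /= => /andP[].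
move=> y; rewrite mem_enum !inE -[y \in s]mem_enum -(perm_mem ts).
rewrite !mem_cat inE; case: eqP => [->|] //=.
by move: us; rewrite (perm_uniq (permEl (perm_catCA t1 [:: x] t2))) /= mem_cat => /andP[/negPf].
Qed.

Lemma sum_faces (a : {set V} -> {set V} -> nat) n (s : {set V}) (t : seq V) u :
  #|s| = n.+2 -> perm_eq t (enum s) ->
  (\sum_(j < n.+2) oriented K n (face j t) *~
    ((-1) ^+ j * (a s [set x in face j t])%:Z)) u =
  (-1) ^+ inversions t *
  \sum_(x in s) (-1) ^+ rank_in s x *
    ((val u == s :\ x)%:R * (a s (s :\ x))%:Z).
Proof.
move=> sn ts; rewrite sum_ffunE -[in RHS]big_enum -(perm_big _ ts) /=.
have st : size t = n.+2 by rewrite (perm_size ts) -cardE.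
have [x0 _] : {x0 | x0 \in t} by case: (t) st => // x; exists x; rewrite mem_head.
rewrite (big_nth x0) st big_mkord mulr_sumr; apply: eq_bigr => j _.
have jt : (j < size t)%N by rewrite st.
have tE : t = take j t ++ nth x0 t j :: drop j.+1 t.
  by rewrite -drop_nth // cat_take_drop.
have ts' := ts; rewrite tE in ts'.
have pf := perm_face ts'; have := sign_face ts'.
rewrite -tE -/(face j t) (size_takel (ltnW jt)) !exprD.
set x := nth x0 t j in pf *; rewrite -/(face j t) in pf.
have -> : [set y in face j t] = s :\ x.
  by apply/setP => y; rewrite inE (perm_mem pf) mem_enum.
rewrite ffunMzE ffunE (permPl pf).
have -> : perm_eq (enum (s :\ x)) (enum (val u)) = (val u == s :\ x).
  apply/idP/eqP => [/perm_mem E|->//].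
  by apply/setP => y; rewrite -[LHS]mem_enum -E mem_enum.
move=> sg; case: eqP => _; last by rewrite mul0rz !mul0r !mulr0.
by rewrite mul1r mulrzz 2!mulrA sg.
Qed.

Lemma oriented_swap n (t1 t2 : seq V) x y : x != y ->
  oriented K n (t1 ++ y :: x :: t2) = - oriented K n (t1 ++ x :: y :: t2).
Proof.
move=> xy; apply/ffunP => u; rewrite !ffunE.
have /permPl-> : perm_eq (t1 ++ [:: y; x] ++ t2) (t1 ++ [:: x; y] ++ t2).
  by rewrite perm_cat2l perm_cat2r (perm_catC [:: y]).
case: ifP => _; last by rewrite oppr0.
have : (enum_rank x < enum_rank y)%N = ~~ (enum_rank y < enum_rank x)%N.
  rewrite -leqNgt [RHS]leq_eqVlt; case: eqP => //.
  by move=> /val_inj/enum_rank_inj xE; rewrite xE eqxx in xy.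
move=> r; rewrite -[RHS]mulN1r -exprS -[t1 ++ x :: _]cat_rcons.
rewrite !inversions_cat_cons -cats1 -catA count_cat /= r inversions_cat_cons !addnA addn0.
rewrite -signr_odd -[RHS]signr_odd; congr (_ ^+ _); rewrite oddS !oddD.
case: (_ < _)%N => /=.
all: by move: (odd _) (odd _) (odd _) (odd _) (odd _) => [] [] [] [] [].
Qed.

Lemma lin_ext_oriented (M : zmodType) n (F : simplex K n -> M)
    (s : simplex K n) t :
  perm_eq t (enum (val s)) ->
  lin_ext F (oriented K n t) = F s *~ (-1) ^+ inversions t.
Proof.
move=> ts; rewrite /lin_ext (bigD1 s) //= ffunE ts big1 ?addr0 // => u us.
rewrite ffunE (permPl ts) ifN ?mulr0z //; apply: contra us => /perm_mem E.
apply/eqP/val_inj/setP => x.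
by rewrite -[LHS]mem_enum -E mem_enum.
Qed.

(* The defining formula of the boundary holds for every ordering of the
   vertices of a simplex, not just the reference one. *)
Lemma boundary_oriented (a : {set V} -> {set V} -> nat) n (t : seq V) :
  uniq t -> size t = n.+2 -> [set x in t] \in simplices K ->
  boundary K a n (oriented K n.+1 t) =
  \sum_(j < n.+2) oriented K n (face j t) *~
    ((-1) ^+ j * (a [set x in t] [set x in face j t])%:Z).
Proof.
set s := [set x in t] => ut st sK.
have ts : perm_eq t (enum s).
  by apply: uniq_perm; rewrite ?enum_uniq // => x; rewrite mem_enum inE.
have sn : #|s| = n.+2 by rewrite cardE -(perm_size ts).
have sP : (s \in simplices K) && (#|s| == n.+2) by rewrite sK sn eqxx.
rewrite /boundary /= (@lin_ext_oriented _ _ _ (exist _ s sP)) //.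
apply/ffunP => u; rewrite ffunMzE !sum_faces // inversions_enum expr0 mul1r.
by rewrite mulrzz mulrC.
Qed.

Lemma boundary_coef (a : {set V} -> {set V} -> nat) n (c : chain K n.+1) u :
  boundary K a n c u =
  \sum_s c s * \sum_(x in val s) (-1) ^+ rank_in (val s) x *
    ((val u == val s :\ x)%:R * (a (val s) (val s :\ x))%:Z).
Proof.
rewrite /boundary /= /lin_ext sum_ffunE; apply: eq_bigr => s _.
have sn : #|val s| = n.+2 by case: s => s /= /andP[_ /eqP].
by rewrite ffunMzE sum_faces // inversions_enum expr0 mul1r mulrzz mulrC.
Qed.

End Orientation.

Section Boundary_square.

Variables (V : finType) (ty : weight_type) (K : simplicial_complex V).

Lemma weight_coefM mu (s s' s'' : {set V}) :
  is_weight ty K mu ->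
  s \in simplices K -> s' \in simplices K -> s'' \in simplices K ->
  s' \subset s -> s'' \subset s' ->
  (weight_coef ty mu s s' * weight_coef ty mu s' s'')%N =
  weight_coef ty mu s s''.
Proof.
case=> pos dvd sK s'K s''K ss ss'; have := dvd _ _ sK s'K ss.
have := dvd _ _ s'K s''K ss'; rewrite /weight_coef.
have [p p' p''] := And3 (pos _ sK) (pos _ s'K) (pos _ s''K).
case: ty => /dvdnP[l El] /dvdnP[k Ek].
  by rewrite Ek mulnK // El mulnA !mulnK.
by rewrite El mulnK // Ek mulnA !mulnK // mulnC.
Qed.

Lemma rank_in_swap (s : {set V}) x y : x \in s -> y \in s -> x != y ->
  (-1) ^+ rank_in s x * (-1) ^+ rank_in (s :\ x) y =
  - ((-1) ^+ rank_in s y * (-1) ^+ rank_in (s :\ y) x) :> int.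
Proof.
have rankD x' y' : x' \in s ->
    rank_in s y' = ((enum_rank x' < enum_rank y')%N + rank_in (s :\ x') y')%N.
  move=> xs; rewrite /rank_in (cardsD1 x') !inE xs /=; congr (_ + _)%N.
  by apply: eq_card => z; rewrite !inE andbA.
move=> xs ys xy; rewrite (rankD y x ys) (rankD x y xs).
have -> : (enum_rank x < enum_rank y)%N = ~~ (enum_rank y < enum_rank x)%N.
  rewrite -leqNgt [RHS]leq_eqVlt; case: eqP => //.
  by move=> /val_inj/enum_rank_inj xE; rewrite xE eqxx in xy.
rewrite !exprD; case: (_ < _)%N => /=; rewrite ?expr0 ?expr1; ring.
Qed.

Lemma wboundary_wboundary mu n (c : chain K n.+2) :
  is_weight ty K mu -> wboundary ty K mu n (wboundary ty K mu n.+1 c) = 0.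
Proof.
move=> wmu; apply/ffunP => w; rewrite /wboundary boundary_coef ffunE.
under eq_bigr => u _ do rewrite boundary_coef mulr_suml.
rewrite exchange_big /= big1 // => s _.
under eq_bigr => u _ do rewrite -mulrA.
rewrite -mulr_sumr; apply/eqP; rewrite mulf_eq0; apply/orP; right.
case: s w => s /= /andP[sK /eqP sn] [w /= /andP[wK /eqP wn]].
under eq_bigr => u _ do rewrite mulr_suml.
rewrite exchange_big /=.
pose g x y : int := (-1) ^+ rank_in s x * (-1) ^+ rank_in (s :\ x) y *
  ((w == s :\ x :\ y)%:R * (weight_coef ty mu s w)%:Z).
have gN x y : x \in s -> y \in s -> x != y -> g x y = - g y x.
  move=> xs ys xy; rewrite /g rank_in_swap // mulNr; congr (- (_ * _)).
  by rewrite !setDDl setUC.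
have -> : \sum_(x in s) \sum_(u : simplex K n.+1)
    (-1) ^+ rank_in s x * ((val u == s :\ x)%:R * (weight_coef ty mu s (s :\ x))%:Z) *
    (\sum_(y in val u) (-1) ^+ rank_in (val u) y *
      ((w == val u :\ y)%:R * (weight_coef ty mu (val u) (val u :\ y))%:Z)) =
    \sum_(x in s) \sum_(y in s | x != y) g x y.
  apply: eq_bigr => x xs.
  have uK : (s :\ x \in simplices K) && (#|s :\ x| == n.+2).
    have un : #|s :\ x| = n.+2 by move: sn; rewrite (cardsD1 x) xs => -[].
    rewrite un eqxx andbT (face_closed sK) ?subD1set //.
    by rewrite -card_gt0 un.
  pose u0 : simplex K n.+1 := exist _ (s :\ x) uK.
  rewrite (bigD1 u0) //= [X in _ + X]big1 ?addr0; last first.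
    move=> u ux; have /negPf-> : val u != s :\ x by [].
    by rewrite mul0r mulr0 mul0r.
  rewrite eqxx mul1r mulr_sumr.
  apply: eq_big => [y|y]; first by rewrite !inE andbC eq_sym.
  rewrite !inE => /andP[yx ys]; rewrite /g; case: eqP => [wE|_]; last first.
    by rewrite !mul0r !mulr0.
  rewrite -wE -(weight_coefM wmu sK (proj1 (andP uK)) wK) ?subD1set //; last first.
    by rewrite wE subD1set.
  rewrite PoszM; ring.
set S := (X in X == 0).
have : S = - S.
  rewrite {1}/S (exchange_big_dep (fun x => x \in s)) /=; last first.
    by move=> x y _ /andP[].
  rewrite /S -sumrN; apply: eq_bigr => x xs; rewrite -sumrN.
  rewrite (eq_bigl (fun y => (y \in s) && (x != y))) => [|y]; last first.
    by rewrite xs eq_sym.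
  by apply: eq_bigr => y /andP[ys xy]; apply: gN; rewrite // eq_sym.
lia.
Qed.

End Boundary_square.

Section Divisible_weights.

Variables (V : finType) (ty : weight_type) (K : simplicial_complex V).
Variable xi : {set V} -> nat.
Hypothesis xiP : is_divisible ty K xi.

Lemma flag_desc (C : {set {set V}}) : C \in simplices (Sd K) ->
  exists t0 (ts : seq {set V}),
    [/\ perm_eq (t0 :: ts) (enum C),
        sorted (fun s t : {set V} => t \subset s) (t0 :: ts) & cover C = t0].
Proof.
rewrite inE => /and3P[C0 _ /forall_inP Cc].
pose r (s t : {set V}) := (#|t| <= #|s|)%N.
have rtr : transitive r by move=> s t u /[swap]; apply: leq_trans.
have [t0 [ts ps]] : exists t0 ts, sort r (enum C) = t0 :: ts.
  case ps : (sort r (enum C)) => [|t0 ts]; last by exists t0, ts.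
  move: C0; rewrite -card_gt0 cardE -(size_sort r) ps //.
have pC : perm_eq (t0 :: ts) (enum C) by rewrite -ps perm_sort.
have inC : all [in C] (t0 :: ts).
  by apply/allP => s; rewrite (perm_mem pC) mem_enum.
have sr : sorted r (t0 :: ts) by rewrite -ps sort_sorted // => s t; exact: leq_total.
have sub s t : s \in C -> t \in C -> r s t -> t \subset s.
  move=> sC tC rst; have /forall_inP/(_ t tC)/orP[st|//] := Cc s sC.
  by have /eqP-> : s == t by rewrite eqEcard st.
exists t0, ts; split=> //.
  by apply: (sub_in_sorted _ inC sr) => s t sC tC; apply: sub.
have t0C : t0 \in C by case/andP: inC.
apply/eqP; rewrite eqEsubset bigcup_sup // andbT; apply/bigcupsP => s sC.
have : s \in t0 :: ts by rewrite (perm_mem pC) mem_enum.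
rewrite inE => /predU1P[->//|sts]; apply: sub => //.
by move: sr => /= /(order_path_min rtr)/allP; apply.
Qed.

Lemma Sd_weight_divisible : is_divisible ty (Sd K) (Sd_weight xi).
Proof.
have [[pos dvd] _] := xiP.
have subK C : C \in simplices (Sd K) -> {subset C <= simplices K}.
  by rewrite inE => /and3P[_ /subsetP].
have coverC C : C \in simplices (Sd K) -> cover C \in C.
  move=> /flag_desc[t0 [ts [/perm_mem Cts _ ->]]].
  by rewrite -mem_enum -Cts mem_head.
have coverK C : C \in simplices (Sd K) -> cover C \in simplices K.
  by move=> CK; apply: (subK C) => //; apply: coverC.
have cover1 (s : {set V}) : Sd_weight xi [set s] = xi s.
  by rewrite /Sd_weight /cover big_set1.
split; [split|].
- by move=> C CK; apply/pos/coverK.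
- move=> C D CK DK DC; apply: dvd; rewrite ?coverK //.
  by apply/bigcupsP => s sD; apply: bigcup_sup; apply: (subsetP DC).
move=> C CK; have [t0 [ts [pC sC cC]]] := flag_desc CK.
have inK : all [in simplices K] (t0 :: ts).
  by apply/allP => s; rewrite (perm_mem pC) mem_enum => /(subK C CK).
rewrite {2}/Sd_weight cC; case tyE : ty dvd => dvd.
  have sK : sorted (fun t s => xi t %| xi s)%N (rev (t0 :: ts)).
    rewrite rev_sorted; apply: (sub_in_sorted _ inK sC) => s t /= sK tK ts'.
    exact: dvd.
  case rE : (rev (t0 :: ts)) => [|v0 vs].
    by move/(congr1 size): rE; rewrite size_rev.
  exists v0, vs; split.
  - by rewrite -rE perm_rev.
  - rewrite -rE (eq_map cover1) sorted_map; exact: sK.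
  by rewrite /= cover1 -[last v0 vs]/(last v0 (v0 :: vs)) -rE rev_cons last_rcons.
exists t0, ts; split; [exact: pC| |by rewrite cover1].
rewrite (eq_map cover1) sorted_map.
by apply: (sub_in_sorted _ inK sC) => s t /= sK tK ts'; apply: dvd.
Qed.

Lemma inversion_exists : exists xihat, is_inversion ty K xi xihat.
Proof.
have [[pos dvd] div] := xiP.
pose xihat (s : {set V}) := match ty with
  | Ascending => \big[gcdn/0%N]_(v in s) xi [set v]
  | Descending => \big[lcmn/1%N]_(v in s) xi [set v]
  end.
have vK s v : s \in simplices K -> v \in s -> [set v] \in simplices K.
  move=> sK vs; apply: (face_closed sK); rewrite ?sub1set //.
  by apply/set0Pn; exists v; rewrite inE.
have xihat1 v : xihat [set v] = xi [set v].
  by rewrite /xihat !big_set1; case: ty.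
have xihatE (s : {set V}) v0 vs : perm_eq (v0 :: vs) (enum s) ->
    sorted dvdn [seq xi [set v] | v <- v0 :: vs] ->
    xihat s = match opposite ty with
              | Ascending => xi [set last v0 vs]
              | Descending => xi [set v0]
              end.
  move=> ps; rewrite sorted_map /xihat -!big_enum -!(perm_big _ ps).
  have tr : transitive (relpre (fun v : V => xi [set v]) dvdn).
    by move=> a b c; apply: dvdn_trans.
  case: ty => /= so.
    apply/eqP; rewrite eqn_dvd big_cons dvdn_gcdl dvdn_gcd dvdnn /=.
    have /allP min := order_path_min tr so.
    rewrite big_seq; elim/big_ind: _ => // a b xa xb;
      by rewrite dvdn_gcd xa.
  have so' : sorted (fun a b => xi [set b] %| xi [set a])%N (rev (v0 :: vs)).
    by rewrite rev_sorted.
  have [q rE] : exists q, rev (v0 :: vs) = last v0 vs :: q.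
    by rewrite lastI rev_rcons; eexists.
  rewrite -(perm_big _ (permEl (perm_rev (v0 :: vs)))) rE /=.
  rewrite rE in so'.
  apply/eqP; rewrite eqn_dvd big_cons dvdn_lcml dvdn_lcm dvdnn andbT /=.
  have tr' : transitive (fun a b => xi [set b] %| xi [set a])%N.
    by move=> a b c /[swap]; apply: dvdn_trans.
  have /allP min := order_path_min tr' so'.
  rewrite big_seq; elim/big_ind: _ => // a b xa xb;
    by rewrite dvdn_lcm xa.
exists xihat; split=> [|v _]; last exact: xihat1.
split; [split|].
- move=> s sK; have [v0 [vs [ps so _]]] := div s sK; rewrite (xihatE s v0 vs ps so).
  have inK v : v \in v0 :: vs -> (0 < xi [set v])%N.
    by rewrite (perm_mem ps) mem_enum => /(vK _ _ sK)/pos.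
  by case: (opposite ty); apply: inK; rewrite ?mem_last ?mem_head.
- move=> s s' sK s'K /subsetP ss; rewrite /xihat; case: ty => /=.
    apply/dvdn_biggcdP => v /ss vs; exact: (@biggcdn_inf _ v).
  by apply/dvdn_biglcmP => v /ss vs; exact: (@biglcmn_sup _ v).
move=> s sK; have [v0 [vs [ps so _]]] := div s sK.
exists v0, vs; split; [exact: ps|by rewrite (eq_map xihat1)|].
by rewrite (xihatE s v0 vs ps so) !xihat1.
Qed.

End Divisible_weights.

(* Main.v *)
Require Import Defs.
From HB Require Import structures.
From mathcomp Require Import all_boot all_order all_algebra.
From mathcomp Require Import zify ring.

(* Rescaling each simplex s by mu s (ascending case) or 1 / mu s (descending
   case) identifies a weighted chain complex with a lattice in the ordinary
   rational chains, with the ordinary boundary.  A map or homotopy of ordinary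
   chains therefore yields a weighted one as soon as it preserves the lattices,
   which is a divisibility condition on the supports of its values.

   Choose a vertex p s of every simplex s with xi (p s) = xi s.  Subdivision, a
   chain map from Sd K to K carried by b_s |-> p s, and a homotopy from the
   identity of Sd K to their composite are all built by coning, from s, from
   p (s_l) and from b_(s_l) respectively, where s_l is the largest member of a
   flag.  The composite on K is the identity, since on a simplex s its value is
   a multiple of s with the same boundary as s.  The weight of a flag depends
   only on s_l for Sd_weight xi, and only on the smallest member for its
   inversion; in both cases all three maps preserve the lattices. *)

Set Implicit Arguments.
Unset Strict Implicit.
Unset Printing Implicit Defensive.

Import GRing.Theory.
Local Open Scope ring_scope.

(** * Linear extension of maps from a finite basis *)

Section LinExt.

Variables (I J : finType) (M : zmodType).

Definition basis (i : I) : {ffun I -> int} := [ffun j => (j == i)%:R].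

Lemma lin_ext_basis (F : I -> M) i : lin_ext F (basis i) = F i.
Proof.
rewrite /lin_ext (bigD1 i) //= ffunE eqxx big1 ?addr0 // => j /negPf ji.
by rewrite ffunE ji mulr0z.
Qed.

Lemma basis_sum (c : {ffun I -> int}) : c = lin_ext basis c.
Proof.
apply/ffunP => j; rewrite /lin_ext sum_ffunE (bigD1 j) //= ffunMzE ffunE eqxx.
rewrite big1 ?addr0 => [|i /negPf ij]; first by rewrite intz.
by rewrite ffunMzE ffunE eq_sym ij mul0rz.
Qed.

Lemma eq_lin_ext (F G : I -> M) (c : {ffun I -> int}) :
  (forall i, c i != 0 -> F i = G i) -> lin_ext F c = lin_ext G c.
Proof.
move=> FG; apply: eq_bigr => i _.
by have [->|/FG->] := eqVneq (c i) 0; rewrite ?mulr0z.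
Qed.

Lemma lin_extB (F G : I -> M) c :
  lin_ext (fun i => F i - G i) c = lin_ext F c - lin_ext G c.
Proof. by rewrite /lin_ext -sumrB; apply: eq_bigr => i _; rewrite mulrzBl. Qed.

Lemma lin_extD (F G : I -> M) c :
  lin_ext (fun i => F i + G i) c = lin_ext F c + lin_ext G c.
Proof. by rewrite /lin_ext -big_split; apply: eq_bigr => i _; rewrite mulrzDl. Qed.

Lemma lin_extMz (F : I -> M) z c :
  lin_ext (fun i => F i *~ z) c = lin_ext F c *~ z.
Proof.
by rewrite /lin_ext mulrz_suml; apply: eq_bigr => i _; rewrite -!mulrzA mulrC.
Qed.

Lemma lin_ext0 c : lin_ext (fun _ : I => 0 : M) c = 0.
Proof. by rewrite /lin_ext big1 // => i _; rewrite mul0rz. Qed.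

Lemma raddf_lin_ext (N : zmodType) (f : {additive M -> N}) (F : I -> M) c :
  f (lin_ext F c) = lin_ext (fun i => f (F i)) c.
Proof. by rewrite /lin_ext raddf_sum; apply: eq_bigr => i _; rewrite raddfMz. Qed.

Lemma lin_ext_coef (F : I -> {ffun J -> int}) c j :
  lin_ext F c j = \sum_i F i j * c i.
Proof.
by rewrite /lin_ext sum_ffunE; apply: eq_bigr => i _; rewrite ffunMzE mulrzz.
Qed.

Lemma lin_ext_supp (F : I -> {ffun J -> int}) c j :
  lin_ext F c j != 0 -> exists2 i, c i != 0 & F i j != 0.
Proof.
rewrite /lin_ext sum_ffunE => nz.
have [i /andP[ci Fij]] : exists i, (c i != 0) && (F i j != 0).
  apply/existsP; apply: contraNT nz => /existsPn no.
  rewrite big1 // => i _; rewrite ffunMzE; apply/eqP; rewrite mulrz_eq0.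
  by have := no i; rewrite negb_and !negbK.
by exists i.
Qed.

End LinExt.

Lemma setD1_ind (T : finType) (P : {set T} -> Prop) :
  (forall s : {set T}, (forall x, x \in s -> P (s :\ x)) -> P s) -> forall s, P s.
Proof.
move=> PS s; have [n] := ubnP #|s|; elim: n s => // n IH s sn.
by apply: PS => x xs; apply: IH; move: sn; rewrite (cardsD1 x) xs.
Qed.

(** * Boundary and cone operators on augmented simplicial chains *)

Section AugmentedChains.

Variable V : finType.
Implicit Types (s t u : {set V}) (x b : V).

(* The chains of the full simplex on V augmented by the empty simplex: here
   the cone operators contract the boundary without any side condition. *)
Definition achain := {ffun {set V} -> int}.

Definition dset s : achain :=
  \sum_(x in s) basis (s :\ x) *~ (-1) ^+ rank_in s x.

(** The sign moves [b] from the front to its place in the reference ordering of [b |: s]; coning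
    from a vertex of [s] is degenerate and gives 0. *)
Definition cset b s : achain :=
  if b \in s then 0 else basis (b |: s) *~ (-1) ^+ rank_in s b.

Lemma lin_ext_dset (M : zmodType) (F : {set V} -> M) s :
  lin_ext F (dset s) = \sum_(x in s) F (s :\ x) *~ (-1) ^+ rank_in s x.
Proof.
by rewrite raddf_sum; apply: eq_bigr => x _; rewrite raddfMz /= lin_ext_basis.
Qed.

Lemma rank_inU1 s x : rank_in (x |: s) x = rank_in s x.
Proof.
rewrite /rank_in; apply: eq_card => y; rewrite !inE.
by case: eqP => [->|] //=; rewrite ltnn andbF.
Qed.

Lemma rank_inD1 s x : rank_in (s :\ x) x = rank_in s x.
Proof.
rewrite /rank_in; apply: eq_card => y; rewrite !inE.
by case: eqP => [->|] //=; rewrite ltnn andbF.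
Qed.

Lemma signrz (M : zmodType) (m : M) k : m *~ (-1) ^+ k *~ (-1) ^+ k = m.
Proof. by rewrite -mulrzA -expr2 sqrr_sign. Qed.

Lemma cset_coef b s t : cset b s t != 0 -> b \in t /\ s = t :\ b.
Proof.
rewrite /cset; case: ifPn => [_|bs]; first by rewrite ffunE eqxx.
rewrite ffunMzE ffunE; have [->|] := eqVneq t; last by rewrite mul0rz eqxx.
by rewrite setU11 setU1K.
Qed.

Lemma dset_coef s t : dset s t != 0 -> exists2 x, x \in s & t = s :\ x.
Proof.
move=> nz; have [x /andP[xs /eqP ->]] : exists x, (x \in s) && (t == s :\ x).
  apply/existsP; apply: contraNT nz => /existsPn no.
  rewrite sum_ffunE big1 // => x xs; rewrite ffunMzE ffunE.
  by have := no x; rewrite xs /= => /negPf ->; rewrite mul0rz.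
by exists x.
Qed.

(** If [b] lies in [s], only the face [s :\ b] has a non-zero cone, which is [s]. Otherwise the face
    of [b |: s] opposite to [b] is [s], and the other faces cancel against the cones over the faces
    of [s]. *)
Lemma boundary_cone b s :
  lin_ext dset (cset b s) + lin_ext (cset b) (dset s) = basis s.
Proof.
rewrite lin_ext_dset /cset; have [bs|bs] := boolP (b \in s).
  rewrite raddf0 add0r (bigD1 b) //= setD11 rank_inD1 setD1K // signrz.
  rewrite big1 ?addr0 // => x /andP[xs xb].
  by rewrite !inE eq_sym xb bs mul0rz.
have sE x : (x \in b |: s) && (x != b) = (x \in s).
  by rewrite !inE; case: eqP => [->|]; rewrite ?(negPf bs) ?andbF ?andbT.
rewrite raddfMz /= lin_ext_basis /dset (bigD1 b) ?setU11 //=.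
rewrite setU1K // rank_inU1 mulrzDl signrz -addrA -[RHS]addr0; congr (_ + _).
rewrite mulrz_suml (eq_bigl _ _ sE).
rewrite -big_split big1 //= => x xs.
have xb : x != b by apply: contraNneq bs => <-.
have sD : (b |: s) :\ x = b |: (s :\ x).
  by apply/setP => y; rewrite !inE; case: eqP => // ->; rewrite (negPf xb).
rewrite !inE eq_sym (negPf xb) (negPf bs) /=.
rewrite sD.
rewrite -!mulrzA -mulrzDr.
have := @rank_in_swap _ (b |: s) x b.
rewrite !inE eqxx xs orbT => /(_ isT isT xb).
rewrite sD.
rewrite setU1K // !rank_inU1 => sw.
suff -> : (-1) ^+ rank_in (b |: s) x * (-1) ^+ rank_in s b +
   (-1) ^+ rank_in (s :\ x) b * (-1) ^+ rank_in s x = 0 :> int by [].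
(* [sw] relates the same four signs, paired differently, so a case check on their values
   suffices. *)
have sgn k : (-1) ^+ k = 1 :> int \/ (-1) ^+ k = -1 :> int.
  by rewrite -signr_odd; case: odd; rewrite ?expr0 ?expr1; [right|left].
move: sw.
case: (sgn (rank_in (b |: s) x)) => ->; case: (sgn (rank_in s b)) => ->.
all: case: (sgn (rank_in (s :\ x) b)) => ->; case: (sgn (rank_in s x)) => ->.
all: lia.
Qed.

Lemma boundary_cone_chain b (c : achain) :
  lin_ext dset (lin_ext (cset b) c) = c - lin_ext (cset b) (lin_ext dset c).
Proof.
apply/(canRL (addrK _)); rewrite [RHS]basis_sum.
rewrite !raddf_lin_ext -lin_extD; apply/eq_lin_ext => s _.
exact: boundary_cone.
Qed.

(** Up to sign [s] is the cone C t over t = [s :\ b]. Using D C = 1 - C D twice gives D D C t = C D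
    D t, which vanishes by induction. *)
Lemma boundary_boundary s : lin_ext dset (dset s) = 0.
Proof.
elim/setD1_ind: s => s IH; have [->|[b bs]] := set_0Vmem s.
  by rewrite /dset big_set0 raddf0.
have -> : dset s =
    lin_ext dset (lin_ext (cset b) (basis (s :\ b))) *~ (-1) ^+ rank_in s b.
  rewrite lin_ext_basis /cset setD11 setD1K // rank_inD1 raddfMz signrz.
  by rewrite /= lin_ext_basis.
rewrite !raddfMz /= boundary_cone_chain raddfB /= boundary_cone_chain.
by rewrite lin_ext_basis IH // raddf0 subr0 subrr mul0rz.
Qed.

End AugmentedChains.

(** * Chain maps and homotopies built by iterated coning *)

Section ConeRec.

Variables (V W : finType).
Implicit Types (s t : {set V}) (u : {set W}).
Variables (a : {set V} -> W) (y : {set V} -> achain W) (r0 : achain W).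
Variable eta : int.

Fixpoint cone_iter k s : achain W :=
  if k is k'.+1
  then lin_ext (cset (a s)) (y s - lin_ext (cone_iter k') (dset s) *~ eta)
  else r0.

(* The solution R of D R + eta R D = y obtained by coning off, from the apex
   a s, the chain that R s has to bound. *)
Definition cone_rec s := cone_iter #|s| s.

Lemma cone_rec0 : cone_rec set0 = r0.
Proof. by rewrite /cone_rec cards0. Qed.

Lemma cone_recE s : s != set0 ->
  cone_rec s = lin_ext (cset (a s)) (y s - lin_ext cone_rec (dset s) *~ eta).
Proof.
rewrite -card_gt0 /cone_rec; case sk : #|s| => [//|k] _ /=.
suff -> : lin_ext (cone_iter k) (dset s) =
    lin_ext (fun t => cone_iter #|t| t) (dset s) by [].
rewrite !lin_ext_dset.
by apply: eq_bigr => x xs; move: sk; rewrite (cardsD1 x) xs => -[<-].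
Qed.

(** By induction and D y = [eta] y D, the chain being coned off is a cycle, so it is the boundary of
    its cone, whatever the apex. With [eta = -1] and [y = 0] the solution is a chain map; with
    [eta = 1] it is a homotopy. *)
Lemma cone_recP :
  lin_ext (@dset W) r0 = y set0 ->
  (forall s, lin_ext (@dset W) (y s) = lin_ext y (dset s) *~ eta) ->
  forall s, lin_ext (@dset W) (cone_rec s) + lin_ext cone_rec (dset s) *~ eta =
    y s.
Proof.
move=> Dr0 Dy; elim/setD1_ind => s IH; have [->|s0] := eqVneq s set0.
  by rewrite cone_rec0 {2}/dset big_set0 raddf0 mul0rz addr0.
rewrite cone_recE //; set c := y s - _.
have Dc : lin_ext (@dset W) c = 0.
  rewrite raddfB raddfMz /= Dy -mulrzBl; apply/eqP.
  suff -> : lin_ext (@dset W) (lin_ext cone_rec (dset s)) = lin_ext y (dset s).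
    by rewrite subrr mul0rz.
  (* Adding [eta] times this zero chain lets the induction hypothesis apply face by face. *)
  have DD : lin_ext cone_rec (lin_ext (@dset V) (dset s)) = 0.
    by rewrite boundary_boundary raddf0.
  rewrite !raddf_lin_ext in DD *.
  rewrite -[LHS]addr0 -[X in _ + X](mul0rz _ eta) -DD -lin_extMz -lin_extD.
  rewrite !lin_ext_dset; apply: eq_bigr => x xs; congr (_ *~ _).
  exact: IH.
by rewrite boundary_cone_chain Dc raddf0 subr0 subrK.
Qed.

(** Any simplex occurring in [cone_rec s] is the apex joined to a simplex of [y s] or of the value
    at a face. All support statements below are instances of this induction. *)
Lemma cone_rec_supp (Q : {set V} -> {set W} -> Prop) :
  (forall u, r0 u != 0 -> Q set0 u) ->
  (forall s u, s != set0 -> a s \in u ->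
     y s (u :\ a s) != 0 \/ (exists2 x, x \in s & Q (s :\ x) (u :\ a s)) ->
     Q s u) ->
  forall s u, cone_rec s u != 0 -> Q s u.
Proof.
move=> Q0 QS; elim/setD1_ind => s IH u; have [->|s0] := eqVneq s set0.
  by rewrite cone_rec0; apply: Q0.
rewrite cone_recE // => /lin_ext_supp[t yt /cset_coef[au tE]].
move: yt; rewrite {}tE !ffunE ffunMzE => yR; apply: QS => //.
have [y0|] := eqVneq (y s (u :\ a s)) 0; last by left.
right; move: yR; rewrite y0 add0r oppr_eq0 mulrz_neq0 => /andP[_].
move=> /lin_ext_supp[v /dset_coef[x xs ->] Rx].
by exists x => //; apply: IH.
Qed.

End ConeRec.

Lemma cone_rec_chain_map (V W : finType) (a : {set V} -> W) s :
  let R := cone_rec a (fun _ => 0) (basis set0) (-1) in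
  lin_ext (@dset W) (R s) = lin_ext R (dset s).
Proof.
move=> R; have := @cone_recP V W a (fun _ => 0) (basis set0) (-1) _ _ s.
rewrite -/R => RP; apply/eqP; rewrite -subr_eq0; apply/eqP; apply: RP => [|t].
  by rewrite lin_ext_basis /dset big_set0.
by rewrite lin_ext0 raddf0 mul0rz.
Qed.

(** * Subdivision, its retraction and the homotopy, without weights *)

Section Subdivision.

Variables (V : finType).
Implicit Types (s t : {set V}) (F G : {set {set V}}).

Definition chained F :=
  [forall s in F, forall t in F, (s \subset t) || (t \subset s)].

Lemma chainedP F :
  reflect {in F &, forall s t, (s \subset t) || (t \subset s)} (chained F).
Proof.
apply: (iffP idP) => [/'forall_in_'forall_in_orP cF s t sF tF|cF].
  exact/orP/cF.
by apply/'forall_in_'forall_in_orP => s sF t tF; apply/orP/cF.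
Qed.

Lemma chainedS F G : F \subset G -> chained G -> chained F.
Proof.
move=> /subsetP FG /chainedP cG; apply/chainedP => s t sF tF.
by apply: cG; apply: FG.
Qed.

(** A member of maximal cardinality contains all the others, hence is the union. *)
Lemma chained_cover F : F != set0 -> chained F -> cover F \in F.
Proof.
move=> /set0Pn[s0 s0F] /chainedP cF.
have [s sF smax] := arg_maxnP (fun s => #|s|) s0F.
suff -> : cover F = s by [].
apply/eqP; rewrite eqEsubset bigcup_sup // andbT; apply/bigcupsP => t tF.
have /orP[//|st] := cF _ _ tF sF.
by have /eqP-> : s == t by rewrite eqEcard st; apply: smax.
Qed.

Lemma chainedU1 F s :
  (forall t, t \in F :\ s -> t \subset s) -> chained (F :\ s) -> chained F.
Proof.
move=> Fs /chainedP cF; apply/chainedP => t u tF uF.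
have [->|ts] := eqVneq t s; last first.
  have [->|us] := eqVneq u s; first by rewrite Fs // !inE ts.
  by apply: cF; rewrite !inE ?ts ?us.
have [->|us] := eqVneq u s; first by rewrite subxx.
by rewrite orbC Fs // !inE us.
Qed.

(** The apex map is [id] because the barycenter of [s] is encoded by [s]; the empty simplex is sent
    to itself. *)
Definition sd : {set V} -> achain {set V} :=
  cone_rec id (fun _ => 0) (basis set0) (-1).

Lemma sd_supp s F : sd s F != 0 ->
  [/\ #|F| = #|s|, chained F,
      forall t, t \in F -> t != set0 /\ t \subset s & s != set0 -> s \in F].
Proof.
pose Q s F := [/\ #|F| = #|s|, chained F,
  forall t, t \in F -> t != set0 /\ t \subset s & s != set0 -> s \in F].
apply: (@cone_rec_supp _ _ _ _ _ _ Q) => {s F} [F|s F s0 sF].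
  rewrite ffunE; have [-> _|_] := eqVneq F set0; last by rewrite eqxx.
  split; rewrite ?cards0 ?eqxx //.
    by apply/chainedP => t u; rewrite inE.
  by move=> t; rewrite inE.
case=> [|[x xs [cF chF Fs _]]]; first by rewrite ffunE eqxx.
have Fs' t : t \in F :\ s -> t != set0 /\ t \subset s.
  by move=> /Fs[? ts]; split=> //; apply: subset_trans ts (subsetDl _ _).
split=> //; first by rewrite (cardsD1 s) sF cF (cardsD1 x s) xs.
  by apply: (chainedU1 _ chF) => t /Fs'[].
move=> t tF; have [->//|ts] := eqVneq t s.
by apply: Fs'; rewrite !inE ts.
Qed.

Variables (K : simplicial_complex V) (p : {set V} -> V).
Hypothesis pP : forall s, s \in simplices K -> p s \in s.

(* The apexes p (cover F) only produce simplices of p @: F, so this plays the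
   role of the simplicial map b_s |-> p s without orientation signs. *)
Definition retract : {set {set V}} -> achain V :=
  cone_rec (fun F => p (cover F)) (fun _ => 0) (basis set0) (-1).

(** Unlike membership in [Sd K], this admits the empty family, so it passes to every [F :\ s] in
    inductions down to [set0]. *)
Definition flagged F := (F \subset simplices K) && chained F.

Lemma flaggedD1 F s : flagged F -> flagged (F :\ s).
Proof.
case/andP=> FK cF; rewrite /flagged (chainedS _ cF) ?subsetDl // andbT.
exact: subset_trans (subsetDl _ _) FK.
Qed.

Lemma retract_supp F s : retract F s != 0 -> flagged F ->
  [/\ #|s| = #|F|, s \subset p @: F & F != set0 -> p (cover F) \in s].
Proof.
pose Q F s := flagged F ->
  [/\ #|s| = #|F|, s \subset p @: F & F != set0 -> p (cover F) \in s].
apply: (@cone_rec_supp _ _ _ _ _ _ Q) => {s F} [s|F s F0 ps].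
  rewrite ffunE; have [-> _ _|_] := eqVneq s set0; last by rewrite eqxx.
  by rewrite !cards0 sub0set eqxx.
case=> [|[t tF Qt] fF]; first by rewrite ffunE eqxx.
have [ct /subsetP st _] := Qt (flaggedD1 t fF).
split=> //; first by rewrite (cardsD1 (p (cover F))) ps ct (cardsD1 t F) tF.
apply/subsetP => x xs; have [->|xp] := eqVneq x (p (cover F)).
  by apply/imset_f/chained_cover; case/andP: fF.
have /st/imsetP[u uF ->] : x \in s :\ p (cover F) by rewrite !inE xp.
by apply: imset_f; move: uF; rewrite inE => /andP[].
Qed.

(** A simplex in the value is spanned by points [p t] with [t] inside [s], so it lies in [s]; having
    as many vertices, it equals [s]. The value is thus a multiple of [s], and its boundary fixes the
    factor. *)
Lemma retract_sd s : (s != set0 -> s \in simplices K) ->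
  lin_ext retract (sd s) = basis s.
Proof.
elim/setD1_ind: s => s IH sK; have [s0|s0] := eqVneq s set0.
  by rewrite s0 /sd cone_rec0 lin_ext_basis /retract cone_rec0.
have sup u : lin_ext retract (sd s) u != 0 -> u = s.
  move=> /lin_ext_supp[F /sd_supp[cF chF Fs _] Fu].
  have FK : F \subset simplices K.
    by apply/subsetP => t /Fs[t0 ts]; apply: face_closed (sK s0) ts t0.
  have [|cu uF _] := retract_supp Fu; first by rewrite /flagged FK.
  apply/eqP; rewrite eqEcard cu cF leqnn andbT.
  apply/subsetP => x /(subsetP uF)/imsetP[t tF ->].
  by have [_ /subsetP] := Fs t tF; apply; apply/pP/(subsetP FK).
have xE : lin_ext retract (sd s) = basis s *~ lin_ext retract (sd s) s.
  apply/ffunP => u; rewrite ffunMzE ffunE; have [->|us] := eqVneq u s.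
    by rewrite intz.
  by rewrite mul0rz; apply/eqP; apply: contraNT us => /sup ->.
have Dx : lin_ext (@dset V) (lin_ext retract (sd s)) = dset s.
  rewrite raddf_lin_ext [LHS](eq_lin_ext (G := fun F => lin_ext retract (dset F))).
    rewrite -raddf_lin_ext /= cone_rec_chain_map raddf_lin_ext lin_ext_dset.
    apply: eq_bigr => x xs; rewrite /= IH // => sx0.
    exact: face_closed (sK s0) (subsetDl _ _) sx0.
  by move=> F _; apply: cone_rec_chain_map.
(* The face [s :\ x] has coefficient 1 or -1 in the boundary of [s]; comparing coefficients there
   shows that the factor is 1. *)
have [x xs] := set0Pn _ s0.
move: Dx; rewrite {1}xE raddfMz /= lin_ext_basis => /ffunP/(_ (s :\ x)).
rewrite ffunMzE; have : dset s (s :\ x) != 0.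
  rewrite /dset sum_ffunE (bigD1 x) //= big1 => [|y /andP[ys yx]].
    by rewrite ffunMzE ffunE eqxx addr0 mulrz_neq0 signr_eq0 oner_eq0.
  rewrite ffunMzE ffunE; case: eqP => [/setP/(_ y)|]; last by rewrite mul0rz.
  by rewrite !inE eqxx ys yx.
move=> d0; rewrite mulrzz -[RHS]mulr1 => /(mulfI d0) z1.
by rewrite xE z1.
Qed.

(** The value at the empty flag is 0 because [retract] and [sd] both fix the empty simplex. The apex
    [cover F] contains every set that can occur, so coning produces flags. *)
Definition sd_homotopy : {set {set V}} -> achain {set V} :=
  cone_rec cover (fun F => lin_ext sd (retract F) - basis F) 0 1.

Lemma sd_homotopyP F :
  lin_ext (@dset _) (sd_homotopy F) + lin_ext sd_homotopy (dset F) =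
  lin_ext sd (retract F) - basis F.
Proof.
rewrite -[X in _ + X]mulr1z; apply: cone_recP => [|G].
  by rewrite raddf0 /retract cone_rec0 lin_ext_basis /sd cone_rec0 subrr.
rewrite mulr1z lin_extB -basis_sum raddfB /= lin_ext_basis; congr (_ - _).
rewrite raddf_lin_ext [LHS](eq_lin_ext (G := fun s => lin_ext sd (dset s))).
  by rewrite -raddf_lin_ext /= cone_rec_chain_map raddf_lin_ext.
by move=> s _; apply: cone_rec_chain_map.
Qed.

(** The bound by [cover F] controls weights that depend on the largest member of a flag. The
    dichotomy in the last clause controls the inverted weights, which may be attained at any
    member. *)
Lemma sd_homotopy_supp F G : sd_homotopy F G != 0 -> flagged F ->
  [/\ F != set0, #|G| = #|F|.+1, flagged G, cover F \in G &
      forall t, t \in G -> t \subset cover F /\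
        (t \in F \/ t != set0 /\ t \subset p @: F)].
Proof.
pose Q F G := flagged F ->
  [/\ F != set0, #|G| = #|F|.+1, flagged G, cover F \in G &
      forall t, t \in G -> t \subset cover F /\
        (t \in F \/ t != set0 /\ t \subset p @: F)].
apply: (@cone_rec_supp _ _ _ _ _ _ Q) => {F G} [G|F G F0 cG yR fF].
  by rewrite ffunE eqxx.
have [/subsetP FK chF] := andP fF.
have cF := chained_cover F0 chF.
have pF : p @: F \subset cover F.
  apply/subsetP => x /imsetP[t tF ->].
  by apply/bigcupP; exists t => //; apply/pP/FK.
(* It suffices to control [G] without its apex, which comes from the subdivided retraction of [F],
   from [F] itself, or from the homotopy on a face of [F]. *)
suff [cG' chG' GF] : [/\ #|G :\ cover F| = #|F|, chained (G :\ cover F) &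
    forall t, t \in G :\ cover F -> t \subset cover F /\
        (t \in F \/ t != set0 /\ t \subset p @: F)].
  have GF' t : t \in G -> t \subset cover F /\
        (t \in F \/ t != set0 /\ t \subset p @: F).
    move=> tG; have [->|tc] := eqVneq t (cover F); first by split=> //; left.
    by apply: GF; rewrite !inE tc.
  split=> //; first by rewrite (cardsD1 (cover F)) cG cG'.
  apply/andP; split; last by apply: (chainedU1 _ chG') => t /GF[].
  apply/subsetP => t /GF'[tc [/FK//|[t0 _]]].
  exact: face_closed (FK _ cF) tc t0.
case: yR => [|[t tF Qt]].
  rewrite !ffunE; have [-> _|GF] := eqVneq (G :\ cover F) F.
    by split=> // t tF; split; [apply: bigcup_sup|left].
  rewrite subr0 => /lin_ext_supp[s Fs /sd_supp[cGs chG Gs _]].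
  have [cs sF _] := retract_supp Fs fF.
  split=> //; first by rewrite cGs.
  move=> t /Gs[t0 ts]; have tF := subset_trans ts sF.
  by split; [exact: subset_trans pF|right].
have [_ cG' /andP[_ chG'] _ GF] := Qt (flaggedD1 t fF).
split=> //; first by rewrite cG' (cardsD1 t F) tF.
move=> u /GF[uc uF]; split.
  apply: subset_trans uc _; apply/bigcupsP => v.
  by rewrite inE => /andP[_]; apply: bigcup_sup.
case: uF => [|[u0 uF]]; first by rewrite inE => /andP[_]; left.
by right; split=> //; apply: subset_trans uF (imsetS _ (subsetDl _ _)).
Qed.

End Subdivision.

(** * Transfer of ordinary chain maps to weighted chains *)

Section Weighting.

Variable ty : weight_type.

(** This says that the quotient [wcoef a b] is exact, for [a] the weight of a simplex and [b] that
    of a simplex in its image. *)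
Definition wle (a b : nat) : bool :=
  match ty with Ascending => b %| a | Descending => a %| b end%N.

Definition wcoef (a b : nat) : nat :=
  match ty with Ascending => a %/ b | Descending => b %/ a end%N.

Lemma wlexx a : wle a a.
Proof. by rewrite /wle; case: ty. Qed.

Lemma wcoefxx a : (0 < a)%N -> wcoef a a = 1%N.
Proof. by rewrite /wcoef divnn => ->; case: ty. Qed.

Lemma wcoefM a b c : (0 < a)%N -> (0 < b)%N -> (0 < c)%N ->
  wle a b -> wle b c -> (wcoef a b * wcoef b c)%N = wcoef a c.
Proof.
rewrite /wle /wcoef => a0 b0 c0; case: ty => /dvdnP[k kE] /dvdnP[l lE].
  by rewrite kE mulnK // lE mulnA !mulnK.
by rewrite lE mulnK // kE mulnA !mulnK // mulnC.
Qed.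

Section Twist.

Variables (V W : finType) (K : simplicial_complex V) (L : simplicial_complex W).
Variables (mu : {set V} -> nat) (nu : {set W} -> nat).
Implicit Types (F G : {set V} -> achain W).

(* A map of unweighted chains, given by its integer matrix F, acts on weighted
   chains after rescaling the simplex s by the factor mu s (ascending case) or
   1 / mu s (descending case).  The boundary wboundary is the rescaling of the
   ordinary boundary, and the conditions of carries ensure that the rescaled
   matrix is integral. *)
Definition twist F n m : {additive chain K n -> chain L m} :=
  lin_ext (fun s : simplex K n => [ffun t : simplex L m =>
    F (val s) (val t) * (wcoef (mu (val s)) (nu (val t)))%:Z]).

Definition carries F n m := forall s t,
  s \in simplices K -> #|s| = n.+1 -> F s t != 0 ->
  [/\ t \in simplices L, #|t| = m.+1 & wle (mu s) (nu t)].

Lemma twistE F n m c t : twist F n m c t =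
  \sum_s c s * (F (val s) (val t) * (wcoef (mu (val s)) (nu (val t)))%:Z).
Proof.
by rewrite lin_ext_coef; apply: eq_bigr => s _; rewrite ffunE mulrC.
Qed.

Lemma simplexP n (s : simplex K n) : val s \in simplices K /\ #|val s| = n.+1.
Proof. by case: s => s /= /andP[-> /eqP]. Qed.

Lemma eq_twist F G n m c :
  (forall s, s \in simplices K -> #|s| = n.+1 -> F s = G s) ->
  twist F n m c = twist G n m c.
Proof.
move=> FG; apply/ffunP => t; rewrite !twistE; apply: eq_bigr => s _.
by have [sK sn] := simplexP s; rewrite FG.
Qed.

Lemma twistB F G n m c :
  twist (fun s => F s - G s) n m c = twist F n m c - twist G n m c.
Proof.
apply/ffunP => t; rewrite !ffunE !twistE -sumrB; apply: eq_bigr => s _.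
by rewrite !ffunE; ring.
Qed.

Lemma twistD F G n m c :
  twist (fun s => F s + G s) n m c = twist F n m c + twist G n m c.
Proof.
apply/ffunP => t; rewrite !ffunE !twistE -big_split /=; apply: eq_bigr => s _.
by rewrite !ffunE; ring.
Qed.

Lemma twistE0 n m c : twist (fun _ => 0) n m c = 0.
Proof.
apply/ffunP => t; rewrite twistE [RHS]ffunE big1 // => s _.
by rewrite ffunE mul0r mulr0.
Qed.

Lemma sum_simplex (M : zmodType) n (f : {set V} -> M) :
  (forall s, f s != 0 -> s \in simplices K /\ #|s| = n.+1) ->
  \sum_s f s = \sum_(s : simplex K n) f (val s).
Proof.
move=> fK; rewrite -(big_sub [pred s | (s \in simplices K) && (#|s| == n.+1)] f).
rewrite [RHS]big_mkcond /=; apply: eq_bigr => s _; case: ifPn => // sK.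
apply/eqP; apply: contraNT sK => /fK[sK sn].
by rewrite inE sK sn eqxx.
Qed.

End Twist.

Lemma twist_id (V : finType) (K : simplicial_complex V) mu n c :
  (forall s, s \in simplices K -> 0 < mu s)%N ->
  twist K K mu mu (@basis _) n n c = c.
Proof.
move=> mu0; apply/ffunP => t; rewrite twistE (bigD1 t) //= ffunE eqxx.
rewrite big1 => [|s st]; first by rewrite wcoefxx ?mulr1 ?addr0 ?mu0 //; case: (simplexP t).
by rewrite ffunE eq_sym val_eqE (negPf st) mul0r mulr0.
Qed.

(** By [KF] the intermediate sum runs over simplices of [L] only, and on each non-zero term both
    quotients are exact, so they multiply by [wcoefM]. Identities between ordinary chains thus
    become identities between weighted ones. *)
Lemma twist_comp (V W X : finType) (K : simplicial_complex V)
    (L : simplicial_complex W) (J : simplicial_complex X) mu nu rho F G n m k c :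
  (forall s, s \in simplices K -> 0 < mu s)%N ->
  (forall s, s \in simplices L -> 0 < nu s)%N ->
  (forall s, s \in simplices J -> 0 < rho s)%N ->
  carries K L mu nu F n m -> carries L J nu rho G m k ->
  twist L J nu rho G m k (twist K L mu nu F n m c) =
  twist K J mu rho (fun s => lin_ext G (F s)) n k c.
Proof.
move=> mu0 nu0 rho0 KF LG; apply/ffunP => u; rewrite !twistE.
under eq_bigr => t _ do rewrite twistE mulr_suml.
rewrite exchange_big /=; apply: eq_bigr => s _.
have [sK sn] := simplexP s; have [uK un] := simplexP u.
rewrite /lin_ext sum_ffunE (sum_simplex (K := L) (n := m)); last first.
  move=> t; rewrite ffunMzE mulrz_neq0 => /andP[/(KF _ _ sK sn)[tL tn _] _].
  by [].
rewrite mulr_suml mulr_sumr; apply: eq_bigr => t _.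
have [tL tn] := simplexP t; rewrite ffunMzE mulrzz.
have [->|Fst] := eqVneq (F (val s) (val t)) 0; first by rewrite !(mul0r, mulr0).
have [->|Gtu] := eqVneq (G (val t) (val u)) 0; first by rewrite !(mul0r, mulr0).
have [_ _ st] := KF _ _ sK sn Fst; have [_ _ tu] := LG _ _ tL tn Gtu.
rewrite -(wcoefM (mu0 _ sK) (nu0 _ tL) (rho0 _ uK) st tu) PoszM; ring.
Qed.

Lemma wboundary_twist (V : finType) (K : simplicial_complex V) mu n c :
  wboundary ty K mu n c = twist K K mu mu (@dset V) n.+1 n c.
Proof.
apply/ffunP => u; rewrite /wboundary boundary_coef twistE.
apply: eq_bigr => s _; congr (_ * _); rewrite /dset sum_ffunE mulr_suml.
apply: eq_bigr => x _; rewrite ffunMzE ffunE mulrzz.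
by case: eqP => [->|_]; rewrite ?mul0r ?mulr0 // !mul1r.
Qed.

Lemma carries_dset (V : finType) (K : simplicial_complex V) mu n :
  is_weight ty K mu -> carries K K mu mu (@dset V) n.+1 n.
Proof.
move=> [_ mule] s t sK sn /dset_coef[x xs ->].
have cs : #|s :\ x| = n.+1 by move: sn; rewrite (cardsD1 x) xs => -[].
have tK : s :\ x \in simplices K.
  by apply: (face_closed sK); rewrite ?subD1set // -card_gt0 cs.
by split=> //; rewrite /wle; apply: mule; rewrite ?subD1set.
Qed.

End Weighting.

(** * Comparison of [Sd_op] with the augmented subdivision [sd] *)

Section SdOp.

Variables (V : finType) (K : simplicial_complex V).

Lemma mem_Sd F :
  (F \in simplices (Sd K)) = (F != set0) && flagged K F.
Proof. by rewrite inE. Qed.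

Lemma sd_simplex s F : s \in simplices K -> sd s F != 0 ->
  [/\ F \in simplices (Sd K), #|F| = #|s| & s \in F].
Proof.
move=> sK /sd_supp[cF chF Fs sF]; have s0 := simplex_neq0 sK.
rewrite mem_Sd /flagged chF -card_gt0 cF card_gt0 s0 andbT /=; split=> //.
  by apply/subsetP => t /Fs[t0 ts]; apply: face_closed ts t0.
exact: sF.
Qed.

Definition embed (U : finType) (L : simplicial_complex U) n (c : chain L n) :
    achain U :=
  lin_ext (fun s : simplex L n => basis (val s)) c.

Lemma lin_ext_embed (M : zmodType) (U : finType) (L : simplicial_complex U) n
    (F : {set U} -> M) (c : chain L n) :
  lin_ext F (embed c) = lin_ext (fun s : simplex L n => F (val s)) c.
Proof.
by rewrite raddf_lin_ext; apply: eq_lin_ext => s _; rewrite /= lin_ext_basis.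
Qed.

Lemma embedE (U : finType) (L : simplicial_complex U) n (c : chain L n) s :
  embed c (val s) = c s.
Proof.
rewrite {2}[c]basis_sum /embed /lin_ext !sum_ffunE; apply: eq_bigr => t _.
by rewrite !ffunMzE !ffunE val_eqE.
Qed.

Lemma embed_eq (U : finType) (L : simplicial_complex U) n (c : chain L n)
    (x : achain U) :
  (forall s, x s != 0 -> s \in simplices L /\ #|s| = n.+1) ->
  (forall s, c s = x (val s)) -> embed c = x.
Proof.
move=> xL cx; apply/ffunP => t.
have [/andP[tL tn]|tL] := boolP ((t \in simplices L) && (#|t| == n.+1)).
  have tP : (t \in simplices L) && (#|t| == n.+1) by rewrite tL tn.
  by rewrite -[t]/(val (exist _ t tP : simplex L n)) embedE cx.
have -> : x t = 0.
  by apply/eqP; apply: contraNT tL => /xL[-> ->]; rewrite eqxx.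
rewrite /embed /lin_ext sum_ffunE big1 // => s _; rewrite ffunMzE ffunE.
case: eqP => [ts|_]; last by rewrite mul0rz.
by move: tL; rewrite ts; case: (simplexP s) => -> ->; rewrite eqxx.
Qed.

Lemma embed_boundary n (s : simplex K n.+1) :
  embed (boundary K (fun _ _ => 1%N) n (oriented K n.+1 (enum (val s)))) =
  dset (val s).
Proof.
have [sK sn] := simplexP s; apply: embed_eq => [t|t].
  move=> /dset_coef[x xs ->]; have cs : #|val s :\ x| = n.+1.
    by move: sn; rewrite (cardsD1 x) xs => -[].
  by split=> //; apply: (face_closed sK); rewrite ?subD1set // -card_gt0 cs.
rewrite boundary_coef (bigD1 s) //= [X in _ + X]big1 => [|u us].
  rewrite ffunE perm_refl inversions_enum mul1r addr0 /dset sum_ffunE.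
  by apply: eq_bigr => x _; rewrite ffunMzE ffunE mulrzz mulr1 mulrC.
rewrite ffunE ifN ?mul0r //; apply: contra us => /perm_mem E.
by apply/eqP/val_inj/setP => x; rewrite -[LHS]mem_enum -E mem_enum.
Qed.

(** Since [enum] is sorted, the inversions of [b :: enum s] all involve [b] and number
    [rank_in s b], which is the sign in [cset]. *)
Lemma cone_embed (U : finType) (L : simplicial_complex U) b n (c : chain L n) t :
  cone L b n c t = lin_ext (cset b) (embed c) (val t).
Proof.
rewrite lin_ext_embed /cone /= /lin_ext !sum_ffunE; apply: eq_bigr => s _.
rewrite !ffunMzE ffunE /cset /=; congr (_ *~ _); rewrite inversions_enum addn0.
rewrite (count_rank_in b (perm_refl _)).
have [bs|bs] := boolP (b \in val s).
  rewrite ffunE ifN //; apply: contraL bs => /perm_uniq.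
  by rewrite enum_uniq /= mem_enum => /andP[].
rewrite ffunMzE ffunE.
have -> : perm_eq (b :: enum (val s)) (enum (val t)) = (val t == b |: val s).
  apply/idP/eqP => [/perm_mem E|->].
    by apply/setP => x; rewrite -[LHS]mem_enum -E !inE mem_enum.
  apply: uniq_perm; rewrite ?enum_uniq //= ?mem_enum ?bs ?enum_uniq // => x.
  by rewrite !inE !mem_enum !inE.
by case: eqP => _; rewrite ?mul0rz // intz.
Qed.

(** [Sd_op] starts at vertices but [sd] at the empty simplex; on a vertex [sd] makes one cone over
    the empty simplex, with trivial sign. *)
Lemma sd_vertex (F : simplex (Sd K) 0) s x : s = [set x] ->
  oriented (Sd K) 0 [:: s] F = sd s (val F).
Proof.
move=> ->; rewrite /sd cone_recE; last by apply/set0Pn; exists x; rewrite inE.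
rewrite sub0r mulrN1z opprK lin_ext_dset big_set1 setDv cone_rec0.
have r0 (T : finType) (y : T) : rank_in set0 y = 0%N.
  by apply: eq_card0 => z; rewrite !inE.
rewrite -rank_inD1 setDv r0 mulr1z lin_ext_basis /cset inE setU0 r0 !ffunE /=.
have -> : perm_eq [:: [set x]] (enum (val F)) = (val F == [set [set x]]).
  apply/idP/eqP => [/perm_mem E|->]; last by rewrite enum_set1.
  by apply/setP => t; rewrite -[LHS]mem_enum -E !inE.
by case: eqP.
Qed.

Lemma Sd_opE n (c : chain K n) F :
  Sd_op K n c F = lin_ext (@sd V) (embed c) (val F).
Proof.
elim: n c F => [|n IH] c F.
  rewrite lin_ext_embed /= /lin_ext !sum_ffunE; apply: eq_bigr => s _.
  rewrite !ffunMzE; congr (_ *~ _).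
  have [sK sn] := simplexP s; have /cards1P[x sx] : #|val s| == 1%N by rewrite sn.
  exact: sd_vertex sx.
rewrite lin_ext_embed.
rewrite [LHS](lin_ext_coef (fun s : simplex K n.+1 => cone (Sd K) (val s) n
  (Sd_op K n (boundary K (fun _ _ => 1%N) n (oriented K n.+1 (enum (val s)))))) c F).
rewrite lin_ext_coef; apply: eq_bigr => s _; have [sK sn] := simplexP s.
congr (_ * _); rewrite cone_embed.
rewrite /sd cone_recE ?(simplex_neq0 sK) //= sub0r mulrN1z opprK.
rewrite -/(@sd V); set c' := Sd_op _ _ _.
suff -> : embed c' = lin_ext (@sd V) (dset (val s)) by [].
apply: embed_eq => [G|G].
  move=> /lin_ext_supp[t /dset_coef[x xs ->]].
  have cs : #|val s :\ x| = n.+1 by move: sn; rewrite (cardsD1 x) xs => -[].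
  have tK : val s :\ x \in simplices K.
    by apply: (face_closed sK); rewrite ?subD1set // -card_gt0 cs.
  by move=> /(sd_simplex tK)[GK cG _]; rewrite cG cs.
by rewrite /c' IH embed_boundary.
Qed.

(** When the weight is constant under subdivision, all rescaling quotients are 1. *)
Lemma Sd_op_twist ty mu nu n c :
  (forall s, s \in simplices K -> 0 < mu s)%N ->
  (forall s F, s \in simplices K -> sd s F != 0 -> nu F = mu s) ->
  Sd_op K n c = twist ty K (Sd K) mu nu (@sd V) n n c.
Proof.
move=> mu0 numu; apply/ffunP => F; rewrite Sd_opE twistE lin_ext_embed.
rewrite /lin_ext sum_ffunE; apply: eq_bigr => s _; have [sK sn] := simplexP s.
rewrite ffunMzE mulrzz mulrC; have [->|sF] := eqVneq (sd (val s) (val F)) 0.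
  by rewrite mul0r mulr0.
by rewrite (numu _ _ sK sF) wcoefxx ?mulr1 // mu0.
Qed.

End SdOp.

(** * Homotopy equivalences and their action on homology *)

Section HomotopyEquivalence.

Variables (C D : nat -> zmodType).
Variables (dC : forall n, {additive C n.+1 -> C n}).
Variables (dD : forall n, {additive D n.+1 -> D n}).
Implicit Types f : forall n, {additive C n -> D n}.

Lemma homotopic_id_cycle (k : forall n, C n -> C n) n (z : cycles dC n) :
  chain_homotopic dC dC k (fun n => idfun) ->
  exists c, k n (val z) - val z = dC n c.
Proof.
case=> h [h0 hS]; case: n z => [|n] [c] /= dc; first by exists (h 0 c); rewrite h0.
exists (h n.+1 c); rewrite hS; move/eqP: dc => ->.
by rewrite raddf0 addr0.
Qed.

Lemma eq_homotopy_equivalence f f' :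
  (forall n c, f n c = f' n c) -> chain_homotopy_equivalence dC dD f ->
  chain_homotopy_equivalence dC dD f'.
Proof.
move=> ff' [fP [g [gP [h [h0 hS]] [k [k0 kS]]]]]; split.
  by move=> n c; rewrite -!ff' fP.
exists g; split=> //.
  by exists h; split=> [c|n c] /=; rewrite -ff' ?h0 // hS.
by exists k; split=> [c|n c] /=; rewrite -ff' ?k0 // kS.
Qed.

Lemma trivial_homotopy_equivalence f :
  (forall n (c : C n), c = 0) -> (forall n (c : D n), c = 0) ->
  chain_homotopy_equivalence dC dD f.
Proof.
move=> C0 D0; split; first by move=> n c; rewrite [LHS]D0 [RHS]D0.
exists (fun n => \0 : {additive D n -> C n}); split.
- by move=> n c; rewrite [LHS]C0 [RHS]C0.
- exists (fun n => \0 : {additive C n -> C n.+1}).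
  by split=> [c|n c]; rewrite [LHS]C0 [RHS]C0.
exists (fun n => \0 : {additive D n -> D n.+1}).
by split=> [c|n c]; rewrite [LHS]D0 [RHS]D0.
Qed.

End HomotopyEquivalence.

Lemma hmap_bijective (C D : nat -> zmodType)
    (dC : forall n, {additive C n.+1 -> C n})
    (dD : forall n, {additive D n.+1 -> D n})
    (f : forall n, {additive C n -> D n}) (fP : is_chain_map dC dD f) :
  chain_homotopy_equivalence dC dD f -> forall n, bijective (hmap fP (n := n)).
Proof.
case=> _ [g [gP gf fg]] n; exists (hmap gP (n := n)) => x.
all: rewrite -[x]hclass_repr !hmapE; apply/hclass_eqP.
  exact: (homotopic_id_cycle _ gf).
exact: (homotopic_id_cycle _ fg).
Qed.

(** * Weighted equivalence from divisibility on supports *)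

Section TwistEquivalence.

Variables (V : finType) (ty : weight_type) (K : simplicial_complex V).
Variables (p : {set V} -> V) (mu : {set V} -> nat) (nu : {set {set V}} -> nat).
Hypothesis pP : forall s, s \in simplices K -> p s \in s.
Hypothesis muP : is_weight ty K mu.
Hypothesis nuP : is_weight ty (Sd K) nu.
Hypothesis sd_wle :
  forall s F, s \in simplices K -> sd s F != 0 -> wle ty (mu s) (nu F).
Hypothesis retract_wle : forall F s, F \in simplices (Sd K) ->
  retract p F s != 0 -> wle ty (nu F) (mu s).
Hypothesis homotopy_wle : forall F G, F \in simplices (Sd K) ->
  sd_homotopy p F G != 0 -> wle ty (nu F) (nu G).

Lemma carries_sd n : carries ty K (Sd K) mu nu (@sd V) n n.
Proof.
move=> s F sK sn sF; have [FK Fn _] := sd_simplex sK sF.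
by split; rewrite ?Fn ?sn ?sd_wle.
Qed.

Lemma retract_simplex F s : F \in simplices (Sd K) -> retract p F s != 0 ->
  [/\ s \in simplices K, #|s| = #|F|, s \subset cover F & s \subset p @: F].
Proof.
rewrite mem_Sd => /andP[F0 fF] Fs; have [cs sF _] := retract_supp Fs fF.
have [/subsetP FK chF] := andP fF.
have sc : s \subset cover F.
  apply: subset_trans sF _; apply/subsetP => x /imsetP[t tF ->].
  by apply/bigcupP; exists t => //; apply/pP/FK.
split=> //; apply: face_closed sc _; first exact/FK/chained_cover.
by rewrite -card_gt0 cs card_gt0.
Qed.

Lemma carries_retract n : carries ty (Sd K) K nu mu (retract p) n n.
Proof.
move=> F s FK Fn Fs; have [sK sF _ _] := retract_simplex FK Fs.
by split; rewrite ?sF ?Fn ?retract_wle.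
Qed.

Lemma carries_homotopy n : carries ty (Sd K) (Sd K) nu nu (sd_homotopy p) n n.+1.
Proof.
move=> F G FK Fn FG; have := FK; rewrite mem_Sd => /andP[F0 fF].
have [_ cG fG cFG _] := sd_homotopy_supp pP FG fF.
split; rewrite ?cG ?Fn ?homotopy_wle // mem_Sd fG andbT.
by apply/set0Pn; exists (cover F).
Qed.

Lemma twist_sd_equivalence :
  chain_homotopy_equivalence (wboundary ty K mu) (wboundary ty (Sd K) nu)
    (fun n => twist ty K (Sd K) mu nu (@sd V) n n).
Proof.
have [mu0 _] := muP; have [nu0 _] := nuP.
have dK n := carries_dset (n := n) muP; have dSd n := carries_dset (n := n) nuP.
have cs := carries_sd; have cr := carries_retract; have ch := carries_homotopy.
split.
  move=> n c; rewrite !wboundary_twist.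
  rewrite (twist_comp _ mu0 mu0 nu0 (dK n) (cs n)).
  rewrite (twist_comp _ mu0 nu0 nu0 (cs n.+1) (dSd n)).
  by apply: eq_twist => s _ _; rewrite [RHS]cone_rec_chain_map.
exists (fun n => twist ty (Sd K) K nu mu (retract p) n n); split.
- move=> n c; rewrite !wboundary_twist.
  rewrite (twist_comp _ nu0 nu0 mu0 (dSd n) (cr n)).
  rewrite (twist_comp _ nu0 mu0 mu0 (cr n.+1) (dK n)).
  by apply: eq_twist => s _ _; rewrite [RHS]cone_rec_chain_map.
(* By [retract_sd] the composite on [K] is the identity itself, so the zero homotopy works. *)
- exists (fun n => \0 : {additive chain K n -> chain K n.+1}).
  have gf n c : twist ty (Sd K) K nu mu (retract p) n n
      (twist ty K (Sd K) mu nu (@sd V) n n c) - c = 0.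
    rewrite (twist_comp _ mu0 nu0 mu0 (cs n) (cr n)).
    rewrite (@eq_twist _ _ _ _ _ _ _ _ (@basis _)) ?twist_id ?subrr // => s sK _.
    by rewrite (retract_sd pP).
  by split=> [c|n c]; rewrite [LHS]gf raddf0 ?addr0.
exists (fun n => twist ty (Sd K) (Sd K) nu nu (sd_homotopy p) n n.+1).
have fg n c : twist ty K (Sd K) mu nu (@sd V) n n
      (twist ty (Sd K) K nu mu (retract p) n n c) - c =
    wboundary ty (Sd K) nu n (twist ty (Sd K) (Sd K) nu nu (sd_homotopy p) n n.+1 c) +
    twist ty (Sd K) (Sd K) nu nu (fun F => lin_ext (sd_homotopy p) (dset F)) n n c.
  rewrite wboundary_twist (twist_comp _ nu0 mu0 nu0 (cr n) (cs n)).
  rewrite (twist_comp _ nu0 nu0 nu0 (ch n) (dSd n)).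
  rewrite -{2}(twist_id ty c nu0) -twistB -twistD.
  by apply: eq_twist => F _ _; rewrite sd_homotopyP.
split=> [c|n c]; rewrite [LHS]fg.
  (* In degree 0 the augmented boundary of a vertex is the empty simplex, where [sd_homotopy] is
     0. *)
  rewrite -[RHS]addr0; congr (_ + _); rewrite -[RHS](twistE0 ty (Sd K) nu nu 0 c).
  apply: eq_twist => F _ /eqP/cards1P[s ->].
  by rewrite lin_ext_dset big_set1 setDv /sd_homotopy cone_rec0 mul0rz.
congr (_ + _); rewrite wboundary_twist.
by rewrite (twist_comp _ nu0 nu0 nu0 (dSd n) (ch n)).
Qed.

End TwistEquivalence.

(** * Divisible weights and their inversions *)

Lemma divisible_vertex (V : finType) ty (K : simplicial_complex V) xi s :
  is_divisible ty K xi -> s \in simplices K ->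
  exists2 v, v \in s & xi [set v] = xi s.
Proof.
case=> _ + sK => /(_ s sK)[v0 [vs [/perm_mem ps _ ->]]].
case: ty; [exists (last v0 vs)|exists v0] => //.
  by rewrite -mem_enum -ps mem_last.
by rewrite -mem_enum -ps mem_head.
Qed.

Lemma Sd_weight1 (V : finType) (xi : {set V} -> nat) s :
  Sd_weight xi [set s] = xi s.
Proof. by rewrite /Sd_weight /cover big_set1. Qed.

Lemma Sd_weight_sd (V : finType) (xi : {set V} -> nat) s F :
  s != set0 -> sd s F != 0 -> Sd_weight xi F = xi s.
Proof.
move=> s0 /sd_supp[_ _ Fs sF]; rewrite /Sd_weight; congr xi.
apply/eqP; rewrite eqEsubset bigcup_sup ?sF // andbT.
by apply/bigcupsP => t /Fs[].
Qed.

Section Weights.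

Variables (V : finType) (K : simplicial_complex V) (ty : weight_type).
Variables (xi : {set V} -> nat).
Hypothesis xiP : is_divisible ty K xi.

Variable p : {set V} -> V.
Hypothesis pP : forall s, s \in simplices K -> p s \in s.

(** Only unions of flags matter: flags in [sd s] have union [s], simplices in [retract p F] lie in
    [cover F], and flags in [sd_homotopy p F] have union [cover F]. *)
Lemma Sd_weight_equivalence :
  chain_homotopy_equivalence (wboundary ty K xi)
    (wboundary ty (Sd K) (Sd_weight xi))
    (fun n => twist ty K (Sd K) xi (Sd_weight xi) (@sd V) n n).
Proof.
have [xiw _] := xiP; have [Sdw _] := Sd_weight_divisible xiP.
apply: (twist_sd_equivalence pP) => // [s F sK sF|F s FK Fs|F G FK FG].
- by rewrite (Sd_weight_sd _ (simplex_neq0 sK) sF) wlexx.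
- have [sK _ sc _] := retract_simplex pP FK Fs.
  move: FK; rewrite mem_Sd => /andP[F0 /andP[/subsetP FK chF]].
  by case: xiw => _ /(_ (cover F) s); apply=> //; apply/FK/chained_cover.
move: FK; rewrite mem_Sd => /andP[F0 fF].
have [_ _ _ cG GF] := sd_homotopy_supp pP FG fF.
suff -> : Sd_weight xi G = Sd_weight xi F by rewrite wlexx.
rewrite /Sd_weight; congr xi; apply/eqP; rewrite eqEsubset.
by apply/andP; split; [apply/bigcupsP => t /GF[]|apply: (bigcup_sup (cover F))].
Qed.

Hypothesis pE : forall s, s \in simplices K -> xi [set p s] = xi s.

(** Everything reduces to vertices: an inverted weight is attained at some vertex and is comparable
    with its value at every vertex. Retracting keeps control because [xi] takes the same value on
    the vertex [p s] as on [s]. *)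
Lemma inversion_equivalence xihat Sd_xihat :
  is_inversion ty K xi xihat ->
  is_inversion ty (Sd K) (Sd_weight xi) Sd_xihat ->
  chain_homotopy_equivalence (wboundary (opposite ty) K xihat)
    (wboundary (opposite ty) (Sd K) Sd_xihat)
    (fun n => twist (opposite ty) K (Sd K) xihat Sd_xihat (@sd V) n n).
Proof.
move=> [hatP hat1] [SdhatP Sdhat1].
have [hatw _] := hatP; have [Sdhatw _] := SdhatP.
have vK s v : s \in simplices K -> v \in s -> [set v] \in simplices K.
  move=> sK vs; apply: (face_closed sK); rewrite ?sub1set //.
  by apply/set0Pn; exists v; rewrite inE.
have FvK F s : F \in simplices (Sd K) -> s \in F -> [set s] \in simplices (Sd K).
  move=> FK sF; apply: (face_closed FK); rewrite ?sub1set //.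
  by apply/set0Pn; exists s; rewrite inE.
have inK F s : F \in simplices (Sd K) -> s \in F -> s \in simplices K.
  by rewrite mem_Sd => /andP[_ /andP[/subsetP FK _]] /FK.
have hat_vertex s : s \in simplices K -> exists2 v, v \in s & xihat s = xi [set v].
  move=> sK; have [v vs <-] := divisible_vertex hatP sK.
  by exists v => //; apply/hat1/(vK s).
have Sdhat_vertex F : F \in simplices (Sd K) ->
    exists2 s, s \in F & Sd_xihat F = xi s.
  move=> FK; have [s sF <-] := divisible_vertex SdhatP FK.
  by exists s => //; rewrite Sdhat1 ?Sd_weight1 // (FvK F).
have Sdhat_wle F s : F \in simplices (Sd K) -> s \in F ->
    wle (opposite ty) (Sd_xihat F) (xi s).
  move=> FK sF; rewrite -(Sd_weight1 xi s) -Sdhat1 ?(FvK F) //.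
  by case: Sdhatw => _; apply; rewrite ?sub1set // (FvK F).
have p_wle F v : F \in simplices (Sd K) -> v \in p @: F ->
    wle (opposite ty) (Sd_xihat F) (xi [set v]).
  by move=> FK /imsetP[s sF ->]; rewrite pE ?(inK F) // Sdhat_wle.
apply: (twist_sd_equivalence pP) => // [s F sK sF|F s FK Fs|F G FK FG].
(* [Sd_xihat F] is [xi t] for some [t] in [F], hence [xi] of a vertex of [t], which is also a vertex
   of [s]. *)
- have [FK _ _] := sd_simplex sK sF; have [t tF ->] := Sdhat_vertex F FK.
  have [v vt <-] := divisible_vertex xiP (inK F t FK tF).
  have [_ _ /(_ t tF)[_ /subsetP ts] _] := sd_supp sF.
  rewrite -hat1 ?(vK s) ?ts //.
  by case: hatw => _; apply; rewrite ?sub1set ?(vK s) ?ts.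
- have [sK _ _ /subsetP sp] := retract_simplex pP FK Fs.
  by have [v vs ->] := hat_vertex s sK; apply/p_wle/sp.
have := FK; rewrite mem_Sd => /andP[F0 fF].
have [_ _ fG cG GF] := sd_homotopy_supp pP FG fF.
have GK : G \in simplices (Sd K).
  by rewrite mem_Sd fG andbT; apply/set0Pn; exists (cover F).
have [s sG ->] := Sdhat_vertex G GK.
(* If [s] is not in [F], its vertices lie in [p @: F], and one of them has the value [xi s]. *)
have [_ [sF|[_ /subsetP sp]]] := GF s sG; first exact: Sdhat_wle.
have [v vs <-] := divisible_vertex xiP (inK G s GK sG).
by apply/p_wle/sp.
Qed.

End Weights.

Theorem theorem6p7 (V : finType) (K : simplicial_complex V) (ty : weight_type)
    (xi : {set V} -> nat) (xi_div : is_divisible ty K xi) :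
  (exists SdP : is_chain_map (wboundary ty K xi)
                  (wboundary ty (Sd K) (Sd_weight xi)) (Sd_op K),
     chain_homotopy_equivalence (wboundary ty K xi)
       (wboundary ty (Sd K) (Sd_weight xi)) (Sd_op K) /\
     forall n, bijective (@hmap _ _ _ _ _ SdP n)) /\
  (forall (xihat : {set V} -> nat) (Sd_xihat : {set {set V}} -> nat),
     is_inversion ty K xi xihat ->
     is_inversion ty (Sd K) (Sd_weight xi) Sd_xihat ->
     exists (Sdhat : forall n, {additive chain K n -> chain (Sd K) n})
            (SdhatP : is_chain_map (wboundary (opposite ty) K xihat)
                        (wboundary (opposite ty) (Sd K) Sd_xihat) Sdhat),
       forall n, bijective (@hmap _ _ _ _ _ SdhatP n)).
Proof.
suff [Sd_equiv Sdhat_equiv] :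
    chain_homotopy_equivalence (wboundary ty K xi)
      (wboundary ty (Sd K) (Sd_weight xi)) (Sd_op K) /\
    forall xihat Sd_xihat, is_inversion ty K xi xihat ->
      is_inversion ty (Sd K) (Sd_weight xi) Sd_xihat ->
      chain_homotopy_equivalence (wboundary (opposite ty) K xihat)
        (wboundary (opposite ty) (Sd K) Sd_xihat)
        (fun n => twist (opposite ty) K (Sd K) xihat Sd_xihat (@sd V) n n).
  split=> [|xihat Sd_xihat hatP SdhatP].
    by have [SdP _] := Sd_equiv; exists SdP; split=> //; apply: hmap_bijective.
  have equiv := Sdhat_equiv _ _ hatP SdhatP; have [SdP _] := equiv.
  by eexists; exists SdP; apply: hmap_bijective.
(* The empty complex is treated apart, since [p] needs a point of [V] as default value outside
   [K]. *)
have [K0|[s0 s0K]] := set_0Vmem (simplices K).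
  have K_empty s : s \notin simplices K by rewrite K0 inE.
  have Sd_empty F : F \notin simplices (Sd K).
    by rewrite mem_Sd /flagged K0 subset0; case: eqP.
  have C0 n (c : chain K n) : c = 0.
    by apply/ffunP => s; have [/(negP (K_empty _))] := simplexP s.
  have D0 n (c : chain (Sd K) n) : c = 0.
    by apply/ffunP => F; have [/(negP (Sd_empty _))] := simplexP F.
  by split=> *; apply: trivial_homotopy_equivalence.
have [x0 _] := set0Pn _ (simplex_neq0 s0K).
pose p (s : {set V}) := odflt x0 [pick v in s | xi [set v] == xi s].
have pP s : s \in simplices K -> p s \in s /\ xi [set p s] = xi s.
  move=> sK; rewrite /p; case: pickP => [v /andP[vs /eqP//]|no].
  have [v vs vE] := divisible_vertex xi_div sK.
  by have := no v; rewrite vs vE eqxx.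
split; last first.
  by move=> *; apply: (inversion_equivalence xi_div (p := p)) => // s /pP[].
apply: eq_homotopy_equivalence (Sd_weight_equivalence xi_div (p := p) _).
  move=> n c; rewrite (@Sd_op_twist _ _ ty xi (Sd_weight xi)) //.
    by case: xi_div => [[]].
  by move=> s F sK; apply: Sd_weight_sd (simplex_neq0 sK).
by move=> s /pP[].
Qed.
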